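(* Let $x_1,x_2$ be two distinct points of $\mathbb{S}^2$. (a) If $m\geq 3$ then $\Gamma_2(B_m(\mathbb{S}^2\setminus\{x_1,x_2\}))$ is generated by the elements $p_k=\sigma_1^k\sigma_2\sigma_1^{-(k+1)}$, $r_k=\sigma_1^k\sigma_0\sigma_1^{-(k+1)}$, for all $k\in\mathbb{Z}$, and $q_i=\sigma_i\sigma_1^{-1}$ for $3\leq i\leq m-1$. (b) If $m=3$, then $\Gamma_2(B_3(\mathbb{S}^2\setminus\{x_1,x_2\}))$ is defined (on these generators) by the following relations, where $k\in\mathbb{Z}$: $$p_{k+1}p_{k+2}^{-1}p_k^{-1}=1,\qquad r_{k+1}r_{k+2}^{-1}r_k^{-1}=1,\qquad r_kp_{k+1}r_{k+2}p_{k+2}^{-1}r_{k+1}^{-1}p_k^{-1}=1.$$ (c) If $m\geq 4$ then $\Gamma_2(B_m(\mathbb{S}^2\setminus\{x_1,x_2\}))$ is defined (on these generators) by the following relations, where $k\in\mathbb{Z}$: $$\begin{aligned} &p_{k+1}p_{k+2}^{-1}p_k^{-1}=1\\ &r_{k+1}r_{k+2}^{-1}r_k^{-1}=1\\ &p_kq_3p_{k+2}q_3^{-1}p_{k+1}^{-1}q_3^{-1}=1\\ &p_kq_ip_{k+1}^{-1}q_i^{-1}=1\ \text{ for all }4\leq i\leq m-1\\ &q_iq_jq_i^{-1}q_j^{-1}=1\ \text{ for all }3\leq i<j-1\leq m-2\\ &q_iq_{i+1}q_i=q_{i+1}q_iq_{i+1}\ \text{ for }3\leq i\leq m-2\\ &r_kp_{k+1}r_{k+1}^{-1}p_k^{-1}=1\\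 &r_kq_ir_{k+1}^{-1}q_i^{-1}=1\ \text{ for all }3\leq i\leq m-2\\ &r_kq_{m-1}r_{k+2}q_{m-1}^{-1}r_{k+1}^{-1}q_{m-1}^{-1}=1. \end{aligned}$$
   Context: For a surface $M$, $F_m(M)=\{(y_1,\ldots,y_m)\in M^m: y_i\neq y_j\text{ if }i\neq j\}$, and $B_m(M)=\pi_1(F_m(M)/S_m)$ is the $m$-string braid group of $M$. $\Gamma_2(G)=[G,G]$. For $m\geq 3$, $B_m(\mathbb{S}^2\setminus\{x_1,x_2\})$ (the $m$-string braid group of the annulus) has the following presentation, due to Kent and Peifer: generators $\sigma_0,\sigma_1,\ldots,\sigma_{m-1}$ and $\tau$; relations (indices taken modulo $m$) $\sigma_i\sigma_j=\sigma_j\sigma_i$ if $|i-j|\neq 1,m-1$ and $0\leq i,j\leq m-1$; $\sigma_i\sigma_{i+1}\sigma_i=\sigma_{i+1}\sigma_i\sigma_{i+1}$ for $0\leq i\leq m-1$; and $\tau^{-1}\sigma_i\tau=\sigma_{i+1}$ for $0\leq i\leq m-1$. The elements $\sigma_i$ in the claim are those of this presentation. *)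

(* Defs.v *)
From HB Require Import structures.
From mathcomp Require Import all_boot all_order all_algebra perm.
From mathcomp Require Import all_classical reals topology normedtype homotopy.
From mathcomp Require Import lra.
Set Implicit Arguments.
Unset Strict Implicit.
Unset Printing Implicit Defensive.
Import Order.TTheory GRing.Theory Num.Theory.
Import numFieldNormedType.Exports.
Local Open Scope classical_set_scope.
Local Open Scope group_scope.
Local Open Scope quotient_scope.

Section Groups.
Variable G : groupType.

Definition is_subgroup (H : set G) : Prop :=
  H 1 /\ forall x y, H x -> H y -> H (x / y).

Definition is_normal (H : set G) : Prop :=
  is_subgroup H /\ forall x y, H x -> H (x ^ y).

Definition generated (S : set G) : set G := smallest is_subgroup S.

Definition normal_closure (S : set G) : set G := smallest is_normal S.

Definition Gamma2 : set G := generated [set [~ x, y] | x in setT & y in setT].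

Definition expgz (x : G) (k : int) : G :=
  match k with Posz n => x ^+ n | Negz n => x ^- n.+1 end.

End Groups.
Arguments Gamma2 G : clear implicits.

(* The free group on I is the quotient of the words in the letters
   (i, true) = i and (i, false) = i^-1 by free cancellation. *)
Section FreeGroup.
Variable I : Type.

Definition word := seq (I * bool).
HB.instance Definition _ := gen_eqMixin word.
HB.instance Definition _ := gen_choiceMixin word.

Inductive free_eq : word -> word -> Prop :=
| free_refl u : free_eq u u
| free_sym u v : free_eq u v -> free_eq v u
| free_trans u v w : free_eq u v -> free_eq v w -> free_eq u w
| free_cancel u v i b :
    free_eq (u ++ (i, b) :: (i, ~~ b) :: v) (u ++ v).

Definition free_eqb (u v : word) : bool := `[< free_eq u v >].

Lemma free_eqb_refl : reflexive free_eqb.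
Proof. by move=> u; apply/asboolP; exact: free_refl. Qed.

Lemma free_eqb_sym : symmetric free_eqb.
Proof. by move=> u v; apply/asboolP/asboolP; exact: free_sym. Qed.

Lemma free_eqb_trans : transitive free_eqb.
Proof.
by move=> v u w /asboolP uv /asboolP vw; apply/asboolP; exact: free_trans vw.
Qed.

Canonical free_equiv := EquivRel free_eqb
  free_eqb_refl free_eqb_sym free_eqb_trans.

Definition free : Type := {eq_quot free_equiv}.
HB.instance Definition _ := Choice.on free.

Definition free_pi (u : word) : free := \pi_({eq_quot free_equiv}) u.
Definition free_repr (x : free) : word := repr (x : {eq_quot free_equiv}).

Lemma free_reprK x : free_pi (free_repr x) = x.
Proof. exact: reprK. Qed.

Lemma free_piP u v : free_pi u = free_pi v <-> free_eq u v.
Proof.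
by split=> [/eqmodP/asboolP//|uv]; apply/eqmodP/asboolP.
Qed.

Lemma free_eq_catl u v w : free_eq v w -> free_eq (u ++ v) (u ++ w).
Proof.
elim=> [||? ? ? _ + _|a b i s]; [|by move=> *; exact: free_sym| |].
- by move=> *; exact: free_refl.
- exact: free_trans.
- by rewrite !catA; exact: free_cancel.
Qed.

Lemma free_eq_catr u v w : free_eq u v -> free_eq (u ++ w) (v ++ w).
Proof.
elim=> [||? ? ? _ + _|a b i s]; [|by move=> *; exact: free_sym| |].
- by move=> *; exact: free_refl.
- exact: free_trans.
- by rewrite -!catA /=; exact: free_cancel.
Qed.

Definition word_inv (u : word) : word := rev [seq (l.1, ~~ l.2) | l <- u].

Lemma word_inv_cat u v : word_inv (u ++ v) = word_inv v ++ word_inv u.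
Proof. by rewrite /word_inv map_cat rev_cat. Qed.

Lemma word_invK u : word_inv (word_inv u) = u.
Proof.
rewrite /word_inv map_rev revK -map_comp -[RHS]map_id.
by apply: eq_map => -[i b] /=; rewrite negbK.
Qed.

Lemma free_eq_inv u v : free_eq u v -> free_eq (word_inv u) (word_inv v).
Proof.
elim=> [||? ? ? _ + _|a b i s]; [|by move=> *; exact: free_sym| |].
- by move=> *; exact: free_refl.
- exact: free_trans.
- rewrite !word_inv_cat /word_inv /= !rev_cons -!cats1 -!catA /= negbK.
  by have := free_cancel (word_inv b) (word_inv a) i s.
Qed.

Lemma free_eq_invr u : free_eq (u ++ word_inv u) [::].
Proof.
elim: u => [|[i b] u IH]; first exact: free_refl.
have -> : word_inv ((i, b) :: u) = word_inv u ++ [:: (i, ~~ b)].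
  by rewrite -[_ :: u]/([:: (i, b)] ++ u) word_inv_cat.
rewrite catA; apply: free_trans (free_cancel [::] [::] i b) => /=.
rewrite -[_ :: _ ++ _]/([:: (i, b)] ++ (u ++ word_inv u) ++ [:: (i, ~~ b)]).
rewrite -[[:: _; _]]/([:: (i, b)] ++ [::] ++ [:: (i, ~~ b)]).
exact/free_eq_catl/free_eq_catr.
Qed.

Definition free_one : free := free_pi [::].
Definition free_mul (x y : free) : free :=
  free_pi (free_repr x ++ free_repr y).
Definition free_inv (x : free) : free := free_pi (word_inv (free_repr x)).

Lemma free_piM u v : free_mul (free_pi u) (free_pi v) = free_pi (u ++ v).
Proof.
have E w : free_eq (free_repr (free_pi w)) w by apply/free_piP/free_reprK.
apply/free_piP; apply: free_trans (free_eq_catr _ (E u)) _.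
exact: free_eq_catl.
Qed.

Lemma free_piV u : free_inv (free_pi u) = free_pi (word_inv u).
Proof. exact/free_piP/free_eq_inv/free_piP/free_reprK. Qed.

Lemma free_mulA : associative free_mul.
Proof.
move=> x y z; rewrite -[x]free_reprK -[y]free_reprK -[z]free_reprK.
by rewrite !free_piM catA.
Qed.

Lemma free_mul1 : left_id free_one free_mul.
Proof. by move=> x; rewrite -[x]free_reprK free_piM. Qed.

Lemma free_mulr1 : right_id free_one free_mul.
Proof. by move=> x; rewrite -[x]free_reprK free_piM cats0. Qed.

Lemma free_mulV : right_inverse free_one free_inv free_mul.
Proof.
move=> x; rewrite -[x]free_reprK free_piV free_piM.
exact/free_piP/free_eq_invr.
Qed.

Lemma free_mulVl : left_inverse free_one free_inv free_mul.
Proof.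
move=> x; rewrite -[x]free_reprK free_piV free_piM; apply/free_piP.
by rewrite -{2}[free_repr x]word_invK; exact: free_eq_invr.
Qed.

HB.instance Definition _ := isGroup.Build free
  free_mulA free_mul1 free_mulr1 free_mulVl free_mulV.

Definition gen (i : I) : free := free_pi [:: (i, true)].

End FreeGroup.

(* free_lift g is the homomorphism from the free group extending g. *)
Section FreeLift.
Variables (I : Type) (G : groupType) (g : I -> G).

Definition word_eval (u : word I) : G :=
  \prod_(l <- u) (if l.2 then g l.1 else (g l.1)^-1).

Definition free_lift (x : free I) : G := word_eval (free_repr x).

Lemma word_eval_cat u v : word_eval (u ++ v) = word_eval u * word_eval v.
Proof. exact: big_cat. Qed.

Lemma free_eq_eval u v : free_eq u v -> word_eval u = word_eval v.
Proof.
elim=> [//|//|? ? ? _ -> _ ->//|a b i s].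
rewrite !word_eval_cat; congr (_ * _); rewrite /word_eval !big_cons mulgA /=.
by case: s => /=; rewrite ?mulgV ?mulVg mul1g.
Qed.

Lemma free_liftE u : free_lift (free_pi u) = word_eval u.
Proof. exact/free_eq_eval/free_piP/free_reprK. Qed.

Lemma free_liftM : {morph free_lift : x y / x * y}.
Proof.
move=> x y; rewrite -[x]free_reprK -[y]free_reprK.
rewrite -[_ * _]/(free_mul _ _) free_piM !free_liftE.
exact: word_eval_cat.
Qed.

Lemma free_lift_gen i : free_lift (gen i) = g i.
Proof. by rewrite free_liftE /word_eval big_seq1. Qed.

End FreeLift.

(* The family g generates the subgroup K, and the elements of rel (read as
   relators on g) are defining relations of K for these generators. *)
Definition presents (G : groupType) (K : set G) (I : Type) (g : I -> G)
    (rel : set (free I)) : Prop :=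
  range (free_lift g) = K /\
  [set x | free_lift g x = 1] = normal_closure rel.

Section UnitInterval.
Local Open Scope ring_scope.
Variable R : realType.

Definition unit_interval : Type := [set t : R | 0 <= t <= 1].
HB.instance Definition _ := Topological.on unit_interval.

Lemma clamp_subproof (t : R) :
  Order.max 0 (Order.min 1 t) \in [set t : R | 0 <= t <= 1].
Proof. by rewrite inE /= le_max lexx ge_max ler01 ge_min lexx. Qed.

Definition clamp (t : R) : unit_interval := 
  exist (fun s : R => s \in [set t : R | 0 <= t <= 1]) _ (clamp_subproof t).

Lemma val_clamp t : 0 <= t <= 1 -> sval (clamp t) = t.
Proof. by move=> /andP[t0 t1] /=; rewrite (min_idPr t1) (max_idPr t0). Qed.

Lemma valI (t : unit_interval) : 0 <= sval t <= 1.
Proof. by case: t => t /= /set_mem. Qed.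

Lemma valI_inj (s t : unit_interval) : sval s = sval t -> s = t.
Proof. by move=> st; apply: eq_sig_hprop. Qed.

Lemma clampK (t : unit_interval) : clamp (sval t) = t.
Proof. by apply: valI_inj; rewrite val_clamp // valI. Qed.

Lemma clamp_le0 t : t <= 0 -> clamp t = clamp 0.
Proof.
move=> t0; apply: valI_inj => /=.
by rewrite (min_idPr (le_trans t0 ler01)) (max_idPl t0) (min_idPr ler01) maxxx.
Qed.

Lemma clamp_ge1 t : 1 <= t -> clamp t = clamp 1.
Proof. by move=> t1; apply: valI_inj => /=; rewrite (min_idPl t1) minxx. Qed.

Lemma clamp01_neq : clamp 0 != clamp 1.
Proof.
apply/eqP => /(congr1 sval); rewrite !val_clamp ?lexx ?ler01//.
by apply/eqP; rewrite eq_sym oner_neq0.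
Qed.

HB.instance Definition _ := isBiPointed.Build unit_interval clamp01_neq.

Lemma valI_continuous : continuous (fun t : unit_interval => sval t : R).
Proof. exact: (@initial_continuous _ _ (@set_val R _)). Qed.

Lemma clamp_continuous : continuous clamp.
Proof.
apply: (@continuous_comp_initial _ _ _ (@set_val R _) clamp).
move=> t; rewrite /comp /=.
apply: (@continuous_max R R (cst 0) (fun t => Order.min 1 t)).
  exact: cst_continuous.
apply: (@continuous_min R R (cst 1) id); first exact: cst_continuous.
by move=> ?; exact: cvg_id.
Qed.

Lemma glue_continuous (S T : topologicalType) (a : S -> R) (c : R)
    (f g : S -> T) : continuous a -> continuous f -> continuous g ->
  (forall x, a x = c -> f x = g x) ->
  continuous (fun x => if a x <= c then f x else g x).
Proof.
move=> ca cf cg fg; apply/continuous_subspace_setT.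
have -> : [set: S] = [set x | a x <= c] `|` [set x | c <= a x].
  by apply/seteqP; split=> // x _ /=; apply/orP; exact: le_total.
apply: withinU_continuous.
- rewrite -[X in closed X]/(a @^-1` [set y | y <= c]).
  by move/continuous_closedP: ca; apply; exact: closed_le.
- rewrite -[X in closed X]/(a @^-1` [set y | c <= y]).
  by move/continuous_closedP: ca; apply; exact: closed_ge.
- have wf : {within [set x | a x <= c], continuous f} by exact: continuous_subspaceT.
  apply: subspace_eq_continuous wf => x; rewrite inE /= => xc.
  by rewrite /from_subspace /= xc.
- have wg : {within [set x | c <= a x], continuous g} by exact: continuous_subspaceT.
  apply: subspace_eq_continuous wg => x; rewrite inE /= => cx.
  rewrite /from_subspace /=; case: ifP => // xc.
  by apply/esym/fg/le_anti; rewrite xc cx.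
Qed.

End UnitInterval.
Arguments clamp : simpl never.

Section FundamentalGroup.
Local Open Scope ring_scope.
Variables (R : realType) (X : topologicalType) (x0 : X).
Notation I := (unit_interval R).

Definition loop : Type := {path I from x0 to x0 in X}.
HB.instance Definition _ := Choice.on loop.

Implicit Types f g h : {path I from x0 to x0 in X}.

Definition cat_fun f g (t : I) : X :=
  if 2 * sval t <= 1 then f (clamp (2 * sval t)) else g (clamp (2 * sval t - 1)).

Lemma comp_cts (S T U : topologicalType) (f : S -> T) (g : T -> U) :
  continuous f -> continuous g -> continuous (fun x => g (f x)).
Proof. by move=> cf cg x; apply: (continuous_comp (cf x)); exact: cg. Qed.

Lemma pair_cts (S T U : topologicalType) (f : S -> T) (g : S -> U) :
  continuous f -> continuous g -> continuous (fun x => (f x, g x)).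
Proof. by move=> cf cg x; apply: cvg_pair; [exact: cf|exact: cg]. Qed.

Lemma add_cts (S : topologicalType) (a b : S -> R) :
  continuous a -> continuous b -> continuous (fun x => a x + b x).
Proof. by move=> ca cb x; apply: cvgD; [exact: ca|exact: cb]. Qed.

Lemma opp_cts (S : topologicalType) (a : S -> R) :
  continuous a -> continuous (fun x => - a x).
Proof. by move=> ca x; apply: cvgN; exact: ca. Qed.

Lemma mul_cts (S : topologicalType) (a b : S -> R) :
  continuous a -> continuous b -> continuous (fun x => a x * b x).
Proof. by move=> ca cb x; apply: cvgM; [exact: ca|exact: cb]. Qed.

Lemma cst_cts (S T : topologicalType) (c : T) : continuous (fun _ : S => c).
Proof. exact: cst_continuous. Qed.

Lemma fst_cts (S T : topologicalType) : continuous (@fst S T).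
Proof. by move=> x; exact: cvg_fst. Qed.

Lemma snd_cts (S T : topologicalType) : continuous (@snd S T).
Proof. by move=> x; exact: cvg_snd. Qed.

Lemma loop_cts f : continuous f.
Proof. exact: cts_fun. Qed.

Lemma loop0 f : f (clamp 0) = x0.
Proof. exact: path_zero. Qed.

Lemma loop1 f : f (clamp 1) = x0.
Proof. exact: path_one. Qed.

Lemma cat_fun_continuous f g : continuous (cat_fun f g).
Proof.
have cv : continuous (fun t : I => 2 * sval t).
  by apply: mul_cts; [exact: cst_cts|exact: valI_continuous].
apply: (glue_continuous cv).
- by apply: comp_cts (@loop_cts f); apply: comp_cts cv (@clamp_continuous R).
- apply: comp_cts (@loop_cts g); apply: comp_cts _ (@clamp_continuous R).
  by apply: add_cts => //; exact: cst_cts.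
- by move=> t ->; rewrite subrr loop0 loop1.
Qed.

Lemma cat_fun0 f g : cat_fun f g (clamp 0) = x0.
Proof. by rewrite /cat_fun val_clamp ?lexx ?ler01// mulr0 ler01 loop0. Qed.

Lemma cat_fun1 f g : cat_fun f g (clamp 1) = x0.
Proof.
rewrite /cat_fun val_clamp ?lexx ?ler01//; case: ifP => [?|_]; first by exfalso; lra.
by rewrite (_ : 2 * 1 - 1 = 1 :> R) ?loop1//; lra.
Qed.

Definition loop_cat f g : loop :=
  mk_path (@cat_fun_continuous f g) (cat_fun0 f g) (cat_fun1 f g).

Definition rev_fun f (t : I) : X := f (clamp (1 - sval t)).

Lemma rev_fun_continuous f : continuous (rev_fun f).
Proof.
apply: comp_cts (@loop_cts f); apply: comp_cts _ (@clamp_continuous R).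
apply: add_cts; first exact: cst_cts.
by apply: opp_cts; exact: valI_continuous.
Qed.

Lemma rev_fun0 f : rev_fun f (clamp 0) = x0.
Proof. by rewrite /rev_fun val_clamp ?lexx ?ler01// subr0 loop1. Qed.

Lemma rev_fun1 f : rev_fun f (clamp 1) = x0.
Proof. by rewrite /rev_fun val_clamp ?lexx ?ler01// subrr loop0. Qed.

Definition loop_rev f : loop :=
  mk_path (@rev_fun_continuous f) (rev_fun0 f) (rev_fun1 f).

Definition loop_cst : loop :=
  mk_path (@cst_cts I X x0) (erefl x0) (erefl x0).

Definition homotopic f g : Prop := exists H : I * I -> X,
  [/\ continuous H,
      forall t, H (t, zero) = f t,
      forall t, H (t, one) = g t
    & forall s, H (zero, s) = x0 /\ H (one, s) = x0].

Let val0 : Order.max 0 (Order.min 1 0) = 0 :> R.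
Proof. by rewrite (min_idPr ler01) maxxx. Qed.

Let val1 : Order.max 0 (Order.min 1 1) = 1 :> R.
Proof. by rewrite minxx (max_idPr ler01). Qed.

Lemma homotopic_refl f : homotopic f f.
Proof.
exists (fun p => f p.1); split=> // [|s].
  by apply: comp_cts (@loop_cts f); exact: fst_cts.
by rewrite path_zero path_one.
Qed.

Lemma homotopic_sym f g : homotopic f g -> homotopic g f.
Proof.
move=> [H [cH H0 H1 Hx]].
exists (fun p => H (p.1, clamp (1 - sval p.2))); split=> [|t|t|s].
- apply: comp_cts cH; apply: pair_cts; first exact: fst_cts.
  apply: comp_cts _ (@clamp_continuous R).
  apply: add_cts; first exact: cst_cts.
  by apply: opp_cts; apply: comp_cts (@valI_continuous R); exact: snd_cts.
- by rewrite /= ?(val0, val1) subr0 H1.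
- by rewrite /= ?(val0, val1) subrr H0.
- exact: Hx.
Qed.

Lemma homotopic_trans f g h : homotopic f g -> homotopic g h -> homotopic f h.
Proof.
move=> [H [cH H0 H1 Hx]] [K [cK K0 K1 Kx]].
have cv : continuous (fun p : I * I => 2 * sval p.2).
  apply: mul_cts; first exact: cst_cts.
  by apply: comp_cts (@valI_continuous R); exact: snd_cts.
exists (fun p => if 2 * sval p.2 <= 1 then H (p.1, clamp (2 * sval p.2))
                 else K (p.1, clamp (2 * sval p.2 - 1))); split=> [|t|t|s].
- apply: (glue_continuous cv).
  + apply: comp_cts cH; apply: pair_cts; first exact: fst_cts.
    exact: comp_cts cv (@clamp_continuous R).
  + apply: comp_cts cK; apply: pair_cts; first exact: fst_cts.
    apply: comp_cts _ (@clamp_continuous R).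
    by apply: add_cts => //; exact: cst_cts.
  + by move=> p ->; rewrite subrr; rewrite (H1 p.1) (K0 p.1).
- rewrite /= ?(val0, val1) mulr0 ler01.
  exact: H0.
- rewrite /= ?(val0, val1).
  case: ifP => [?|_]; first by exfalso; lra.
  by rewrite (_ : 2 * 1 - 1 = 1 :> R); [exact: K1|lra].
- by rewrite /=; split; case: ifP => _; (apply: (Hx _).1 || apply: (Hx _).2 ||
    apply: (Kx _).1 || apply: (Kx _).2).
Qed.

Lemma homotopic_cat f f' g g' : homotopic f f' -> homotopic g g' ->
  homotopic (loop_cat f g) (loop_cat f' g').
Proof.
move=> [H [cH H0 H1 Hx]] [K [cK K0 K1 Kx]].
have cv : continuous (fun p : I * I => 2 * sval p.1).
  apply: mul_cts; first exact: cst_cts.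
  by apply: comp_cts (@valI_continuous R); exact: fst_cts.
exists (fun p => if 2 * sval p.1 <= 1 then H (clamp (2 * sval p.1), p.2)
                 else K (clamp (2 * sval p.1 - 1), p.2)); split=> [|t|t|s].
- apply: (glue_continuous cv).
  + apply: comp_cts cH; apply: pair_cts; last exact: snd_cts.
    exact: comp_cts cv (@clamp_continuous R).
  + apply: comp_cts cK; apply: pair_cts; last exact: snd_cts.
    apply: comp_cts _ (@clamp_continuous R).
    by apply: add_cts => //; exact: cst_cts.
  + by move=> p ->; rewrite subrr; rewrite (Hx p.2).2 (Kx p.2).1.
- by rewrite /= H0 K0.
- by rewrite /= H1 K1.
- rewrite /=.
  rewrite ?(val0, val1) mulr0 ler01 (Hx s).1; split=> //.
  case: ifP => [?|_]; first by exfalso; lra.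
  by rewrite (_ : 2 * 1 - 1 = 1 :> R); [exact: (Kx s).2|lra].
Qed.

Lemma homotopic_rev f g : homotopic f g -> homotopic (loop_rev f) (loop_rev g).
Proof.
move=> [H [cH H0 H1 Hx]].
exists (fun p => H (clamp (1 - sval p.1), p.2)); split=> [|t|t|s].
- apply: comp_cts cH; apply: pair_cts; last exact: snd_cts.
  apply: comp_cts _ (@clamp_continuous R).
  apply: add_cts; first exact: cst_cts.
  by apply: opp_cts; apply: comp_cts (@valI_continuous R); exact: fst_cts.
- exact: H0.
- exact: H1.
- rewrite /=.
  by rewrite ?(val0, val1) subr0 subrr (Hx s).1 (Hx s).2.
Qed.

(* Two reparametrizations of the same loop with the same endpoints are
   homotopic, by linear interpolation of the parameters. *)
Lemma homotopic_reparam (h f g : loop) (phi psi : R -> R) :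
  continuous phi -> continuous psi -> phi 0 = psi 0 -> phi 1 = psi 1 ->
  (forall t : I, f t = h (clamp (phi (sval t)))) ->
  (forall t : I, g t = h (clamp (psi (sval t)))) ->
  homotopic f g.
Proof.
move=> cphi cpsi e0 e1 Ef Eg.
pose th (p : I * I) : R :=
  (1 - sval p.2) * phi (sval p.1) + sval p.2 * psi (sval p.1).
exists (fun p => h (clamp (th p))); split=> [|t|t|s].
- apply: comp_cts (@loop_cts h); apply: comp_cts _ (@clamp_continuous R).
  have c1 : continuous (fun p : I * I => sval p.1 : R).
    by apply: comp_cts (@valI_continuous R); exact: fst_cts.
  have c2 : continuous (fun p : I * I => sval p.2 : R).
    by apply: comp_cts (@valI_continuous R); exact: snd_cts.
  apply: add_cts; apply: mul_cts => //.
  + by apply: add_cts; [exact: cst_cts|exact: opp_cts].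
  + exact: comp_cts c1 cphi.
  + exact: comp_cts c1 cpsi.
- rewrite Ef /th /= ?(val0, val1).
  by rewrite subr0 mul1r mul0r addr0.
- rewrite Eg /th /= ?(val0, val1).
  by rewrite subrr mul1r mul0r add0r.
- have E (c : I) : phi (sval c) = psi (sval c) ->
      th (c, s) = phi (sval c).
    by rewrite /th /= => ->; rewrite -mulrDl subrK mul1r.
  rewrite !E; [|by rewrite val_clamp ?lexx ?ler01..].
  by rewrite -Ef -Ef path_zero path_one.
Qed.

Lemma max_cts (a b : R -> R) : continuous a -> continuous b ->
  continuous (fun t => Order.max (a t) (b t)).
Proof. by move=> ca cb t; apply: (@continuous_max R R a b); [exact: ca|exact: cb]. Qed.

Lemma min_cts (a b : R -> R) : continuous a -> continuous b ->
  continuous (fun t => Order.min (a t) (b t)).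
Proof. by move=> ca cb t; apply: (@continuous_min R R a b); [exact: ca|exact: cb]. Qed.

Lemma id_cts (S : topologicalType) : continuous (fun t : S => t).
Proof. by move=> ?; exact: cvg_id. Qed.

Lemma homotopic_cstl f : homotopic (loop_cat loop_cst f) f.
Proof.
apply: (@homotopic_reparam f _ _ (fun t => Order.max 0 (2 * t - 1)) id).
- apply: max_cts; first exact: cst_cts.
  apply: add_cts; last exact: cst_cts.
  by apply: mul_cts; [exact: cst_cts|exact: id_cts].
- exact: id_cts.
- by rewrite mulr0 maxEle; case: ifP => ?; lra.
- by rewrite maxEle; case: ifP => ?; lra.
- move=> t; rewrite /= /mk_path /cat_fun; case: ifP => ht.
    by rewrite (max_idPl _) ?loop0//; lra.
  by rewrite (max_idPr _)//; lra.
- by move=> t; rewrite clampK.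
Qed.

Lemma homotopic_cstr f : homotopic (loop_cat f loop_cst) f.
Proof.
apply: (@homotopic_reparam f _ _ (fun t => Order.min (2 * t) 1) id).
- apply: min_cts; last exact: cst_cts.
  by apply: mul_cts; [exact: cst_cts|exact: id_cts].
- exact: id_cts.
- by rewrite mulr0 minEle; case: ifP => ?; lra.
- by rewrite minEle; case: ifP => ?; lra.
- move=> t; rewrite /= /mk_path /cat_fun; case: ifP => ht.
    by rewrite (min_idPl _).
  by rewrite (min_idPr _) ?loop1//; lra.
- by move=> t; rewrite clampK.
Qed.

Lemma homotopic_catA f g h :
  homotopic (loop_cat f (loop_cat g h)) (loop_cat (loop_cat f g) h).
Proof.
pose phi (t : R) : R := Order.max (Order.max (2^-1 * t) (t - 4^-1)) (2 * t - 1).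
apply: (@homotopic_reparam (loop_cat (loop_cat f g) h) _ _ phi id).
- apply: max_cts; first apply: max_cts.
  + by apply: mul_cts; [exact: cst_cts|exact: id_cts].
  + by apply: add_cts; [exact: id_cts|exact: cst_cts].
  + apply: add_cts; last exact: cst_cts.
    by apply: mul_cts; [exact: cst_cts|exact: id_cts].
- exact: id_cts.
- by rewrite /phi; case: (leP (2^-1 * 0 : R)) => ?; case: leP => ?; lra.
- by rewrite /phi; case: (leP (2^-1 * 1 : R)) => ?; case: leP => ?; lra.
- move=> t; have /andP[t0 t1] := valI t.
  have phiE : phi (sval t) = if 2 * sval t <= 1 then 2^-1 * sval t else
      if 4 * sval t <= 3 then sval t - 4^-1 else 2 * sval t - 1.
    rewrite /phi; case: (leP (2^-1 * sval t)) => ?;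
      case: (leP _ (2 * sval t - 1)) => ?; do 2?case: ifP => ?; lra.
  have phi01 : 0 <= phi (sval t) <= 1.
    by rewrite phiE; do !case: ifP => ?; lra.
  rewrite /= /mk_path {2}/cat_fun val_clamp// phiE.
  rewrite {1}/cat_fun /=.
  case: ifP => h1.
    rewrite ifT; last by lra.
    rewrite /mk_path /cat_fun val_clamp; last by lra.
    rewrite ifT; last by lra.
    by congr (f (clamp _)); lra.
  rewrite /mk_path /cat_fun val_clamp; last by lra.
  case: ifP => h2.
    have h3 : 4 * sval t <= 3 by lra.
    rewrite h3 ifT; last by lra.
    rewrite val_clamp; last by lra.
    rewrite ifF; last by lra.
    by congr (g (clamp _)); lra.
  have h3 : (4 * sval t <= 3) = false by lra.
  by rewrite h3 ifF//; lra.
- by move=> t; rewrite clampK.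
Qed.

Lemma homotopic_catV f : homotopic (loop_cat f (loop_rev f)) loop_cst.
Proof.
apply: (@homotopic_reparam f _ _
  (fun t => Order.min (2 * t) (2 - 2 * t)) (fun=> 0)).
- apply: min_cts; last apply: add_cts.
  + by apply: mul_cts; [exact: cst_cts|exact: id_cts].
  + exact: cst_cts.
  + by apply: opp_cts; apply: mul_cts; [exact: cst_cts|exact: id_cts].
- exact: cst_cts.
- by rewrite minEle; case: ifP => ?; lra.
- by rewrite minEle; case: ifP => ?; lra.
- move=> t; have /andP[t0 t1] := valI t.
  rewrite /= /mk_path /cat_fun; case: ifP => ht.
    by rewrite (min_idPl _)//; lra.
  rewrite (min_idPr _); last by lra.
  rewrite /= /mk_path /rev_fun val_clamp; last by lra.
  by congr (f (clamp _)); lra.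
- by move=> t; rewrite loop0.
Qed.

Lemma homotopic_Vcat f : homotopic (loop_cat (loop_rev f) f) loop_cst.
Proof.
apply: (@homotopic_reparam f _ _
  (fun t => Order.max (1 - 2 * t) (2 * t - 1)) (fun=> 1)).
- apply: max_cts; apply: add_cts; try exact: cst_cts.
  + by apply: opp_cts; apply: mul_cts; [exact: cst_cts|exact: id_cts].
  + by apply: mul_cts; [exact: cst_cts|exact: id_cts].
- exact: cst_cts.
- by rewrite maxEle; case: ifP => ?; lra.
- by rewrite maxEle; case: ifP => ?; lra.
- move=> t; have /andP[t0 t1] := valI t.
  rewrite /= /mk_path /cat_fun; case: ifP => ht.
    rewrite (max_idPl _); last by lra.
    by rewrite /= /mk_path /rev_fun val_clamp//; lra.
  by rewrite (max_idPr _)//; lra.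
- by move=> t; rewrite loop1.
Qed.

Definition homotopicb (f g : loop) : bool := `[< homotopic f g >].

Lemma homotopicb_refl : reflexive homotopicb.
Proof. by move=> f; apply/asboolP; exact: homotopic_refl. Qed.

Lemma homotopicb_sym : symmetric homotopicb.
Proof. by move=> f g; apply/asboolP/asboolP; exact: homotopic_sym. Qed.

Lemma homotopicb_trans : transitive homotopicb.
Proof.
move=> g f h /asboolP fg /asboolP gh; apply/asboolP.
exact: homotopic_trans gh.
Qed.

Canonical homotopic_equiv := EquivRel homotopicb
  homotopicb_refl homotopicb_sym homotopicb_trans.

Definition pi1 : Type := {eq_quot homotopic_equiv}.
HB.instance Definition _ := Choice.on pi1.

Definition loop_class (f : loop) : pi1 := \pi_({eq_quot homotopic_equiv}) f.
Definition loop_repr (a : pi1) : loop := repr (a : {eq_quot homotopic_equiv}).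

Lemma loop_reprK a : loop_class (loop_repr a) = a.
Proof. exact: reprK. Qed.

Lemma loop_classP f g : loop_class f = loop_class g <-> homotopic f g.
Proof. by split=> [/eqmodP/asboolP//|fg]; apply/eqmodP/asboolP. Qed.

Definition pi1_one : pi1 := loop_class loop_cst.
Definition pi1_mul (a b : pi1) : pi1 :=
  loop_class (loop_cat (loop_repr a) (loop_repr b)).
Definition pi1_inv (a : pi1) : pi1 := loop_class (loop_rev (loop_repr a)).

Lemma loop_classM f g :
  pi1_mul (loop_class f) (loop_class g) = loop_class (loop_cat f g).
Proof. by apply/loop_classP/homotopic_cat; exact/loop_classP/loop_reprK. Qed.

Lemma loop_classV f : pi1_inv (loop_class f) = loop_class (loop_rev f).
Proof. by apply/loop_classP/homotopic_rev; exact/loop_classP/loop_reprK. Qed.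

Lemma pi1_mulA : associative pi1_mul.
Proof.
move=> a b c; rewrite -[a]loop_reprK -[b]loop_reprK -[c]loop_reprK.
by rewrite !loop_classM; exact/loop_classP/homotopic_catA.
Qed.

Lemma pi1_mul1 : left_id pi1_one pi1_mul.
Proof.
move=> a; rewrite -[a]loop_reprK loop_classM.
exact/loop_classP/homotopic_cstl.
Qed.

Lemma pi1_mulr1 : right_id pi1_one pi1_mul.
Proof.
move=> a; rewrite -[a]loop_reprK loop_classM.
exact/loop_classP/homotopic_cstr.
Qed.

Lemma pi1_mulVl : left_inverse pi1_one pi1_inv pi1_mul.
Proof.
move=> a; rewrite -[a]loop_reprK loop_classV loop_classM.
exact/loop_classP/homotopic_Vcat.
Qed.

Lemma pi1_mulV : right_inverse pi1_one pi1_inv pi1_mul.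
Proof.
move=> a; rewrite -[a]loop_reprK loop_classV loop_classM.
exact/loop_classP/homotopic_catV.
Qed.

HB.instance Definition _ := isGroup.Build pi1
  pi1_mulA pi1_mul1 pi1_mulr1 pi1_mulVl pi1_mulV.

End FundamentalGroup.

Definition sphere2 (R : realType) : set 'rV[R]_3 :=
  [set v | (\sum_(i < 3) v ord0 i ^+ 2 = 1)%R].
Arguments sphere2 R : clear implicits.

Definition punctured_sphere (R : realType) (x1 x2 : sphere2 R) :
    set (sphere2 R) :=
  [set x | x <> x1 /\ x <> x2].

Section Configurations.
Variables (M : topologicalType) (m : nat).

Definition conf : set {ptws 'I_m -> M} :=
  [set y | forall i j : 'I_m, i <> j -> y i <> y j].

Definition same_orbit (y z : conf) : bool :=
  `[< exists s : 'S_m, forall i, sval z i = sval y (s i) >].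

Lemma same_orbit_refl : reflexive same_orbit.
Proof. by move=> y; apply/asboolP; exists 1 => i; rewrite perm1. Qed.

Lemma same_orbit_sym : symmetric same_orbit.
Proof.
by move=> y z; apply/asboolP/asboolP => -[s E]; exists s^-1 => i; rewrite E permKV.
Qed.

Lemma same_orbit_trans : transitive same_orbit.
Proof.
move=> z y w /asboolP[s Es] /asboolP[t Et]; apply/asboolP; exists (t * s) => i.
by rewrite permM Et Es.
Qed.

Canonical orbit_equiv := EquivRel same_orbit
  same_orbit_refl same_orbit_sym same_orbit_trans.

Definition unordered_conf : topologicalType :=
  quotient_topology {eq_quot orbit_equiv}.

End Configurations.

(* R only provides the parameter interval of the loops; b is the base point. *)
Definition braid_group (R : realType) (M : topologicalType) (m : nat)
    (b : unordered_conf M m) : groupType := pi1 R b.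

Section AnnularPresentation.
Variable m : nat.

Inductive annular_index := Sigma of 'Z_m | Tau.

Notation sigma i := (gen (Sigma i)).
Notation tau := (gen Tau).

(* The relators of Kent and Peifer for the braid group of the annulus.
   In 'Z_m, for m > 1, the values are 0, ..., m-1 and i + 1 is modulo m. *)
Inductive annular_rel : set (free annular_index) :=
| annular_comm (i j : 'Z_m) :
    `|i - j|%N != 1%N -> `|i - j|%N != (m - 1)%N ->
    annular_rel (sigma i * sigma j * (sigma j * sigma i)^-1)
| annular_braid (i : 'Z_m) :
    annular_rel (sigma i * sigma (i + 1)%R * sigma i *
      (sigma (i + 1)%R * sigma i * sigma (i + 1)%R)^-1)
| annular_shift (i : 'Z_m) :
    annular_rel (tau^-1 * sigma i * tau * (sigma (i + 1)%R)^-1).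

Definition annular_gen (G : groupType) (sigma : 'Z_m -> G) (tau : G)
    (a : annular_index) : G :=
  match a with Sigma i => sigma i | Tau => tau end.

End AnnularPresentation.
Arguments annular_rel m : clear implicits.

Section Gamma2Presentation.
Variable m : nat.

Definition q_range : Type := {i : nat | (3 <= i <= m - 1)%N}.

Inductive Gamma2_index := Pidx of int | Ridx of int | Qidx of q_range.

Section Elements.
Variables (G : groupType) (sigma : 'Z_m -> G).

Definition p_elt (k : int) : G :=
  expgz (sigma 1%R) k * sigma 2%:R%R * expgz (sigma 1%R) (- (k + 1))%R.

Definition r_elt (k : int) : G :=
  expgz (sigma 1%R) k * sigma 0%R * expgz (sigma 1%R) (- (k + 1))%R.

Definition q_elt (i : nat) : G := sigma i%:R%R * (sigma 1%R)^-1.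

Definition Gamma2_gen (a : Gamma2_index) : G :=
  match a with
  | Pidx k => p_elt k | Ridx k => r_elt k | Qidx i => q_elt (sval i)
  end.

End Elements.

Notation p k := (gen (Pidx k%R)).
Notation r k := (gen (Ridx k%R)).
Notation q i := (gen (Qidx i)).

Inductive Gamma2_rel_3 : set (free Gamma2_index) :=
| rel3_p (k : int) : Gamma2_rel_3 (p (k + 1) * (p (k + 2))^-1 * (p k)^-1)
| rel3_r (k : int) : Gamma2_rel_3 (r (k + 1) * (r (k + 2))^-1 * (r k)^-1)
| rel3_pr (k : int) :
    Gamma2_rel_3 (r k * p (k + 1) * r (k + 2) *
                  (p (k + 2))^-1 * (r (k + 1))^-1 * (p k)^-1).

Inductive Gamma2_rel_ge4 : set (free Gamma2_index) :=
| rel_p (k : int) : Gamma2_rel_ge4 (p (k + 1) * (p (k + 2))^-1 * (p k)^-1)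
| rel_r (k : int) : Gamma2_rel_ge4 (r (k + 1) * (r (k + 2))^-1 * (r k)^-1)
| rel_pq3 (k : int) (i : q_range) : sval i = 3 ->
    Gamma2_rel_ge4 (p k * q i * p (k + 2) *
                    (q i)^-1 * (p (k + 1))^-1 * (q i)^-1)
| rel_pq (k : int) (i : q_range) : (4 <= sval i <= m - 1)%N ->
    Gamma2_rel_ge4 (p k * q i * (p (k + 1))^-1 * (q i)^-1)
| rel_qq_comm (i j : q_range) :
    (3 <= sval i)%N -> (sval i < sval j - 1)%N -> (sval j - 1 <= m - 2)%N ->
    Gamma2_rel_ge4 (q i * q j * (q i)^-1 * (q j)^-1)
| rel_qq_braid (i i' : q_range) :
    (3 <= sval i <= m - 2)%N -> sval i' = (sval i + 1)%N ->
    Gamma2_rel_ge4 (q i * q i' * q i * (q i' * q i * q i')^-1)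
| rel_rp (k : int) :
    Gamma2_rel_ge4 (r k * p (k + 1) * (r (k + 1))^-1 * (p k)^-1)
| rel_rq (k : int) (i : q_range) : (3 <= sval i <= m - 2)%N ->
    Gamma2_rel_ge4 (r k * q i * (r (k + 1))^-1 * (q i)^-1)
| rel_rq_last (k : int) (i : q_range) : sval i = (m - 1)%N ->
    Gamma2_rel_ge4 (r k * q i * r (k + 2) *
                    (q i)^-1 * (r (k + 1))^-1 * (q i)^-1).

End Gamma2Presentation.
Arguments Gamma2_rel_3 m : clear implicits.
Arguments Gamma2_rel_ge4 m : clear implicits.

(* Main.v *)
(* The braid group G of the annulus is the semidirect product of the Artin group A
   on sigma_0, ..., sigma_(m-1) by the powers of tau, and A in turn is the
   semidirect product of Gamma_2(G) by the powers of sigma_1. All generators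
   of A being conjugate in G, Gamma_2(G) is generated by the conjugates of
   the quotients sigma_j sigma_1^-1 by powers of sigma_1.

   To see that a word w with trivial value follows from the given relators N,
   no quotient group is needed: a free group F with an action of the integers
   that preserves N gives a semidirect product of F by the integers, in which
   the normal closure of N is still normal. The map from the larger free group to
   this product sends defining relators into that normal closure, hence also
   w, which it sends to itself. This is applied once to eliminate tau
   and once to eliminate sigma_1. *)
Require Import Defs.
From HB Require Import structures.
From mathcomp Require Import all_boot all_order all_algebra.
From mathcomp Require Import all_classical reals topology normedtype.
From mathcomp Require Import zify.
Set Implicit Arguments.
Unset Strict Implicit.
Unset Printing Implicit Defensive.
Import Defs GRing.Theory.
Import numFieldNormedType.Exports.
Local Open Scope classical_set_scope.
Local Open Scope group_scope.

(** Rewriting with these rules gives a left-associated product with adjacent inverse factors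
    cancelled. *)
Definition groupE (G : groupType) :=
  (@invgM G, @invgK G, @invg1 G, @mulgA G, @mulgK G, @mulgVK G, @mulgV G,
   @mulVg G, @mul1g G, @mulg1 G).

(** * Subgroups, normal closures and integer powers *)

Section Subgroups.
Variable G : groupType.
Implicit Types (H K S : set G) (x y z : G).

Lemma subgroupV H x : is_subgroup H -> H x -> H x^-1.
Proof. by move=> [H1 HF] Hx; rewrite -div1g; exact: HF. Qed.

Lemma subgroupM H x y : is_subgroup H -> H x -> H y -> H (x * y).
Proof.
move=> sH Hx Hy; rewrite -[y]invgK; case: (sH) => _; apply=> //.
exact: subgroupV.
Qed.

Lemma generated_subgroup S : is_subgroup (generated S).
Proof.
split=> [A [[A1 _] _]//|x y Sx Sy A sA]; have [[_ AF] _] := sA.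
by apply: AF; [exact: Sx|exact: Sy].
Qed.

Lemma sub_generated S : S `<=` generated S.
Proof. exact: sub_smallest. Qed.

Lemma generated_sub S H : is_subgroup H -> S `<=` H -> generated S `<=` H.
Proof. exact: smallest_sub. Qed.

Lemma normal_closure_normal S : is_normal (normal_closure S).
Proof.
split; first split.
- by move=> A [[[A1 _] _] _].
- move=> x y Sx Sy A sA; have [[[_ AF] _] _] := sA.
  by apply: AF; [exact: Sx|exact: Sy].
- by move=> x y Sx A sA; have [[_ AJ] _] := sA; apply: AJ; exact: Sx.
Qed.

Lemma sub_normal_closure S : S `<=` normal_closure S.
Proof. exact: sub_smallest. Qed.

Lemma normal_closure_sub S H : is_normal H -> S `<=` H -> normal_closure S `<=` H.
Proof. exact: smallest_sub. Qed.

Lemma normalJ H x y : is_normal H -> H (x ^ y) <-> H x.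
Proof.
by move=> [_ HJ]; split=> [/HJ-/(_ y^-1)|/HJ//]; rewrite conjgK.
Qed.

Lemma normalMC H x y : is_normal H -> H (x * y) <-> H (y * x).
Proof. by move=> nH; rewrite -(normalJ _ x nH) conjgE !mulgA mulVg mul1g. Qed.

Lemma subgroupVE H x : is_subgroup H -> H x^-1 <-> H x.
Proof. by move=> sH; split=> /(subgroupV sH); rewrite ?invgK. Qed.

Lemma Gamma2_normal : is_normal (Gamma2 G).
Proof.
have sG := generated_subgroup [set [~ x, y] | x in setT & y in (@setT G)].
split=> // x y Gx; rewrite -(mulVKg x (x ^ y)) -commgEl.
apply: (subgroupM sG Gx); apply: sub_generated.
by exists x => //; exists y.
Qed.

(** Both conjugations are required: for infinite [K], conjugation by [y] may map [K] into itself
    while conjugation by [y^-1] does not, and closure under inverses would fail. *)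
Definition normalizer K : set G :=
  [set y | forall x, K x -> K (x ^ y) /\ K (x ^ y^-1)].

Lemma normalizer_subgroup K : is_subgroup (normalizer K).
Proof.
split=> [x Kx|u v Nu Nv x Kx]; first by rewrite invg1 conjg1.
rewrite invgF !conjgM; split; first exact: (Nv _ (Nu _ Kx).1).2.
exact: (Nu _ (Nv _ Kx).1).2.
Qed.

Lemma sub_normalizer K : is_subgroup K -> K `<=` normalizer K.
Proof.
move=> sK u Ku x Kx; have Vu := subgroupV sK Ku.
by split; rewrite conjgE ?invgK; do !apply: (subgroupM sK).
Qed.

Lemma generated_normal S K : is_subgroup K -> generated S = setT ->
  S `<=` normalizer K -> is_normal K.
Proof.
move=> sK genS SN; split=> // x y Kx.
have NT : setT `<=` normalizer K.
  by rewrite -genS; apply: generated_sub SN; exact: normalizer_subgroup.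
exact: (NT y I x Kx).1.
Qed.

Lemma subgroup_expgz K x k : is_subgroup K -> K x -> K (expgz x k).
Proof.
move=> sK Kx; have KX n : K (x ^+ n).
  elim: n => [|n IH]; first by case: sK.
  by rewrite expgS; exact: (subgroupM sK Kx IH).
by case: k => n; rewrite /expgz ?expVgn; [|apply: (subgroupV sK)]; exact: KX.
Qed.

(** As [K] is normal, for fixed [y] the elements [x] with [[~ x, y]] in [K] form a subgroup. Hence
    the condition spreads from generators to all elements, in one argument and then in the other. *)
Lemma commutator_sub S K : is_normal K -> generated S = setT ->
  (forall s t, S s -> S t -> K [~ s, t]) -> Gamma2 G `<=` K.
Proof.
move=> nK genS KS; have [sK KJ] := nK.
have comM u v y : K [~ u, y] -> K [~ v, y] -> K [~ u * v, y].
  move=> Ku Kv; have -> : [~ u * v, y] = [~ u, y] ^ v * [~ v, y].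
    by rewrite !commgEl !conjgE !groupE.
  by apply: subgroupM => //; exact: KJ.
have comV u y : K [~ u, y] -> K [~ u^-1, y].
  move=> Ku; have -> : [~ u^-1, y] = ([~ u, y] ^ u^-1)^-1.
    by rewrite !commgEl !conjgE !groupE.
  by apply: subgroupV => //; exact: KJ.
have comS y : is_subgroup [set x | K [~ x, y]].
  split=> [|u v /= Ku Kv]; first by rewrite /= comm1g; case: sK.
  by apply: comM => //; exact: comV.
have comT y : (forall s, S s -> K [~ s, y]) -> forall x, K [~ x, y].
  move=> Ky x; suff sT : setT `<=` [set x | K [~ x, y]] by exact: sT.
  by rewrite -genS; apply: (generated_sub (comS y)) => s; exact: Ky.
apply: (generated_sub sK) => _ [x _ [y _ <-]].
apply: (comT) => s Ss; rewrite -invgR; apply: subgroupV => //.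
apply: (comT) => t St; exact: KS.
Qed.

Lemma expgzD x k l : expgz x (k + l)%R = expgz x k * expgz x l.
Proof.
have S i : expgz x (i + 1)%R = expgz x i * x.
  case: i => [n|[|n]] /=.
  - by rewrite addn1 expgSr.
  - by rewrite expg0 mulVg.
  - by rewrite subn1 [x ^+ n.+2]expgS invgM mulgVK.
have P i : expgz x (i - 1)%R = expgz x i / x by rewrite -[i in RHS](subrK 1%R) S mulgK.
elim/int_rect: l => [|n IH|n IH].
- by rewrite addr0 mulg1.
- by rewrite intS [(1 + _)%R]addrC addrA !S IH mulgA.
- by rewrite intS opprD [(-1 + _)%R]addrC addrA !P IH mulgA.
Qed.

Lemma expgzN x k : expgz x (- k)%R = (expgz x k)^-1.
Proof. by apply: (@mulgI _ (expgz x k)); rewrite -expgzD subrr mulgV. Qed.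

End Subgroups.

(** * Homomorphisms and the universal property of free groups *)

Section Morphisms.
Variables (G H : groupType) (f : G -> H).
Hypothesis fM : {morph f : x y / x * y}.

Lemma morph1 : f 1 = 1.
Proof. by apply: (@mulgI _ (f 1)); rewrite -fM !mulg1. Qed.

Lemma morphV x : f x^-1 = (f x)^-1.
Proof. by apply: (@mulgI _ (f x)); rewrite -fM !mulgV morph1. Qed.

Lemma morphJ x y : f (x ^ y) = f x ^ f y.
Proof. by rewrite !conjgE !fM morphV. Qed.

Lemma morph_expgz x k : f (expgz x k) = expgz (f x) k.
Proof.
have E n : f (x ^+ n) = f x ^+ n.
  by elim: n => [|n IH]; rewrite ?expg0 ?morph1 // !expgS fM IH.
by case: k => n; rewrite /expgz ?morphV E.
Qed.

Lemma preimage_normal K : is_normal K -> is_normal (f @^-1` K).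
Proof.
move=> [[K1 KF] KJ]; split; first split.
- by rewrite /= morph1.
- by move=> x y /= Kx Ky; rewrite fM morphV; exact: KF.
- by move=> x y /= Kx; rewrite morphJ; exact: KJ.
Qed.

Lemma morph_normal_closure S K : is_normal K -> S `<=` f @^-1` K ->
  normal_closure S `<=` f @^-1` K.
Proof. by move=> nK; apply: normal_closure_sub; exact: preimage_normal. Qed.

Lemma kernel_normal : is_normal [set x | f x = 1].
Proof.
apply: (preimage_normal (K := [set 1])); split; first split=> //.
- by move=> x y -> -> /=; rewrite divg1.
- by move=> x y -> /=; rewrite conj1g.
Qed.

End Morphisms.

Section FreeLiftTheory.
Variables (I : Type) (G : groupType).
Implicit Types (g : I -> G).

Lemma free_lift1 g : free_lift g 1 = 1.
Proof. exact: morph1 (free_liftM g). Qed.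

Lemma free_liftV g x : free_lift g x^-1 = (free_lift g x)^-1.
Proof. exact: morphV (free_liftM g) x. Qed.

Lemma free_ind (P : free I -> Prop) : P 1 ->
  (forall i x, P x -> P (gen i * x)) -> (forall i x, P x -> P ((gen i)^-1 * x)) ->
  forall x, P x.
Proof.
move=> P1 PM PV x; rewrite -[x]free_reprK; elim: (free_repr x) => [//|[i b] u IH].
have -> : free_pi ((i, b) :: u) =
    (if b then gen i else (gen i)^-1) * free_pi u.
  by case: b; rewrite ?[(gen i)^-1]free_piV [RHS]free_piM.
by case: b; [exact: PM|exact: PV].
Qed.

Lemma free_lift_unique g (f : free I -> G) : {morph f : x y / x * y} ->
  f \o @gen I =1 g -> f =1 free_lift g.
Proof.
move=> fM fg; elim/free_ind => [|i x IH|i x IH].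
- by rewrite free_lift1 morph1.
- by rewrite fM free_liftM free_lift_gen -fg IH.
- by rewrite fM free_liftM free_liftV morphV// free_lift_gen -fg IH.
Qed.

Lemma range_free_lift_subgroup g : is_subgroup (range (free_lift g)).
Proof.
split; first by exists 1; rewrite ?free_lift1.
by move=> _ _ [x _ <-] [y _ <-]; exists (x / y); rewrite // free_liftM free_liftV.
Qed.

Lemma range_free_lift g : range (free_lift g) = generated (range g).
Proof.
apply/seteqP; split.
  move=> _ [x _ <-]; have sg := generated_subgroup (range g).
  have gg i : generated (range g) (g i) by apply: sub_generated; exists i.
  elim/free_ind: x => [|i x IH|i x IH].
  - by rewrite free_lift1; case: sg.
  - by rewrite free_liftM free_lift_gen; exact: (subgroupM sg (gg i) IH).
  - rewrite free_liftM free_liftV free_lift_gen.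
    exact: (subgroupM sg (subgroupV sg (gg i)) IH).
apply: generated_sub; first exact: range_free_lift_subgroup.
by move=> _ [i _ <-]; exists (gen i); rewrite ?free_lift_gen.
Qed.

End FreeLiftTheory.

Lemma morph_free_lift (I : Type) (G H : groupType) (f : G -> H) (g : I -> G) :
  {morph f : x y / x * y} -> f \o free_lift g =1 free_lift (f \o g).
Proof.
move=> fM; apply: free_lift_unique => [x y|i] /=.
  by rewrite free_liftM fM.
by rewrite free_lift_gen.
Qed.

(** * Semidirect product of a free group by the integers *)

Record int_action (I : Type) := IntAction {
  iact :> int -> I -> I;
  iact0 : iact 0%R =1 id;
  iactD : forall k l, iact (k + l)%R =1 iact k \o iact l }.

Section SemidirectProduct.
Variables (I : Type) (A : int_action I).

Definition free_act (k : int) : free I -> free I :=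
  free_lift (fun i => gen (A k i)).

Lemma free_actM k : {morph free_act k : x y / x * y}.
Proof. exact: free_liftM. Qed.

Lemma free_act1 k : free_act k 1 = 1. Proof. exact: free_lift1. Qed.

Lemma free_actV k x : free_act k x^-1 = (free_act k x)^-1.
Proof. exact: free_liftV. Qed.

Lemma free_act_gen k i : free_act k (gen i) = gen (A k i).
Proof. exact: free_lift_gen. Qed.

Definition free_actE := (free_actM, free_actV, free_act_gen).

Lemma free_act0 : free_act 0%R =1 id.
Proof.
by apply/fsym/free_lift_unique => // i /=; rewrite iact0.
Qed.

Lemma free_actD k l : free_act (k + l)%R =1 free_act k \o free_act l.
Proof.
apply/fsym/free_lift_unique => [x y|i] /=; first by rewrite !free_actM.
by rewrite !free_act_gen iactD.
Qed.

(* The pair (x, k) stands for x t^k, where t is the generator of int and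
   t x t^-1 = free_act 1 x. *)
Definition semidirect (B : int_action I) : Type := (free I * int)%type.
HB.instance Definition _ := Choice.on (semidirect A).

Implicit Types u v w : semidirect A.

Definition sd_one : semidirect A := (1, 0%R).
Definition sd_mul u v : semidirect A := (u.1 * free_act u.2 v.1, (u.2 + v.2)%R).
Definition sd_inv u : semidirect A := (free_act (- u.2)%R u.1^-1, (- u.2)%R).

Lemma sd_mulA : associative sd_mul.
Proof.
move=> u v w; rewrite /sd_mul /= free_actM free_actD /=.
by rewrite mulgA addrA.
Qed.

Lemma sd_mul1 : left_id sd_one sd_mul.
Proof. by move=> [x k]; rewrite /sd_mul /= free_act0 mul1g add0r. Qed.

Lemma sd_mulr1 : right_id sd_one sd_mul.
Proof. by move=> [x k]; rewrite /sd_mul /= free_act1 mulg1 addr0. Qed.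

Lemma sd_mulVl : left_inverse sd_one sd_inv sd_mul.
Proof.
move=> [x k]; rewrite /sd_mul /sd_inv /= -free_actM mulVg free_act1.
by rewrite addNr.
Qed.

Lemma sd_mulV : right_inverse sd_one sd_inv sd_mul.
Proof.
move=> [x k]; rewrite /sd_mul /sd_inv /=.
by rewrite -[free_act k _]/((free_act k \o free_act (- k)%R) _) -free_actD subrr free_act0 mulgV.
Qed.

HB.instance Definition _ := isGroup.Build (semidirect A)
  sd_mulA sd_mul1 sd_mulr1 sd_mulVl sd_mulV.

Definition sd (x : free I) (k : int) : semidirect A := (x, k).

Lemma sdM x y k l : sd x k * sd y l = sd (x * free_act k y) (k + l)%R.
Proof. by []. Qed.

Lemma sdV x k : (sd x k)^-1 = sd (free_act (- k)%R x^-1) (- k)%R.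
Proof. by []. Qed.

(** Used for relators [u / v] whose sides have the same exponent in [t]: their images lie in the
    free factor. *)
Lemma sdF x y k : sd x k / sd y k = sd (x / y) 0%R.
Proof.
rewrite sdV sdM subrr -[free_act k _]/((free_act k \o free_act (- k)%R) _).
by rewrite -free_actD subrr free_act0.
Qed.

Lemma sd_expgz k : expgz (sd 1 1%R) k = sd 1 k.
Proof.
have E n : sd 1 1%R ^+ n = sd 1 n%:Z.
  by elim: n => [//|n IH]; rewrite expgS IH sdM free_act1 mulg1 -intS.
by case: k => n; rewrite /expgz E // sdV invg1 free_act1 NegzE.
Qed.

Definition iact_stable (rel : set (free I)) := forall k x, rel x -> rel (free_act k x).

(** Conjugation of [(x, 0)] by [(y, k)] is conjugation by [y] in the free group followed by
    [free_act (- k)]; stability of [rel] makes its closure invariant under both. *)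
Lemma sd_normal_closure (rel : set (free I)) : iact_stable rel ->
  is_normal [set u : semidirect A | normal_closure rel u.1 /\ u.2 = 0%R].
Proof.
move=> relA; have nN := normal_closure_normal rel; have [sN NJ] := nN.
have NA k x : normal_closure rel x -> normal_closure rel (free_act k x).
  move: x; apply: (morph_normal_closure (@free_actM k) nN) => x relx.
  by apply: sub_normal_closure; exact: relA.
split; first split=> [|[x k] [y l] /= [Nx ->] [Ny ->]].
- by split=> //; case: sN.
- by rewrite oppr0 !free_act0; case: sN => _ NF; split=> //; exact: NF.
- move=> [x l] [y k] /= [Nx ->].
  rewrite free_act0 add0r addNr -free_actM -conjgE.
  by split=> //; apply: NA; exact: NJ.
Qed.

End SemidirectProduct.

(** * Elimination of [tau] *)

Section Artin.
Variable m : nat.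
Hypothesis m3 : (3 <= m)%N.

Lemma ltn_Zp (i : 'Z_m) : (i < m)%N.
Proof. by rewrite -{2}[m](Zp_cast (ltnW m3)) ltn_ord. Qed.

Lemma val_Zp_succ (i : 'Z_m) :
  (i + 1)%R = (if i == m.-1 :> nat then 0%N else i.+1) :> nat.
Proof.
move: (ltn_Zp i); case: m m3 i => [|[|[|n]]] // _ i im.
rewrite /= (_ : (1 %% _)%N = 1%N) // addn1.
case: eqP => [->|neq].
  exact: modnn.
by apply: modn_small; change (i.+1 < n.+3)%N; lia.
Qed.

(** This presents the Artin group whose diagram is a cycle of length [m]. Adjacency is expressed in
    ['Z_m], which makes invariance under rotation immediate. *)
Inductive artin_rel : set (free 'Z_m) :=
| artin_comm (i j : 'Z_m) : i != (j + 1)%R -> j != (i + 1)%R ->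
    artin_rel (gen i * gen j * (gen j * gen i)^-1)
| artin_braid (i : 'Z_m) :
    artin_rel (gen i * gen (i + 1)%R * gen i *
      (gen (i + 1)%R * gen i * gen (i + 1)%R)^-1).

Definition rotation : int_action 'Z_m.
Proof.
exists (fun k i => (i + k%:~R)%R) => [i|k l i] /=; first by rewrite addr0.
by rewrite addrAC intrD addrA.
Defined.

Lemma artin_rel_rotation : iact_stable rotation artin_rel.
Proof.
move=> k _ [i j ij ji|i]; rewrite !(free_actM, free_actV, free_act_gen) /=.
  by apply: artin_comm; rewrite addrAC (inj_eq (addIr _)).
by rewrite addrAC; exact: artin_braid.
Qed.

(* tau^-1 becomes the generator of int, acting by sigma_i |-> sigma_(i+1). *)
Definition annular_to_sd : free (annular_index m) -> semidirect rotation :=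
  free_lift (annular_gen (fun i => sd _ (gen i) 0%R) (sd _ 1 (-1)%R)).

Let annular_to_sdM : {morph annular_to_sd : x y / x * y} := free_liftM _.

Let annular_to_sd_gen : (forall i, annular_to_sd (gen (Sigma i)) = sd _ (gen i) 0%R) *
  (annular_to_sd (gen (Tau m)) = sd _ 1 (-1)%R).
Proof. by split=> [i|]; exact: free_lift_gen. Qed.

Lemma annular_to_sd_sigma w :
  annular_to_sd (free_lift (fun i => gen (Sigma i)) w) = sd _ w 0%R.
Proof.
have fM : {morph (fun w => sd rotation w 0%R) : x y / x * y}.
  by move=> x y; rewrite sdM free_act0 addr0.
rewrite (free_lift_unique fM (fun=> erefl)).
rewrite -[LHS]/((annular_to_sd \o free_lift (fun i => gen (Sigma i))) w).
apply: free_lift_unique => [x y|i] /=; first by rewrite free_liftM annular_to_sdM.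
by rewrite free_lift_gen annular_to_sd_gen.
Qed.

(** The equality [i = j + 1] in ['Z_m] means distance 1, or distance [m - 1] when the sum wraps
    around. *)
Lemma annular_rel_artin (i j : 'Z_m) :
  `|i - j|%N != 1%N -> `|i - j|%N != (m - 1)%N -> i != (j + 1)%R.
Proof.
move=> ij1 ijm; apply/eqP => /(congr1 val) /= ij.
have := val_Zp_succ j; rewrite /= -ij.
by case: ifP => /eqP jm iE; move: ij1 ijm; rewrite iE; lia.
Qed.

Lemma annular_rel_sd :
  annular_rel m `<=` annular_to_sd @^-1`
    [set u : semidirect rotation | normal_closure artin_rel u.1 /\ u.2 = 0%R].
Proof.
pose simp := (annular_to_sdM, morphV annular_to_sdM, annular_to_sd_gen, sdM, sdF,
  free_act0, addr0).
have sub x : artin_rel x ->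
    normal_closure artin_rel (sd rotation x 0%R).1 /\ (sd rotation x 0%R).2 = 0%R.
  by move=> relx; split=> //; exact: sub_normal_closure.
move=> _ [i j ij1 ijm|i|i]; rewrite /preimage /mkset !simp.
- by apply/sub/artin_comm; apply: annular_rel_artin; rewrite // distnC.
- exact/sub/artin_braid.
(* The shift relator becomes the identity itself, because conjugation by the image of [tau] is the
   action. *)
- rewrite (sdV _ 1) invg1 free_act1 opprK /= mul1g mulg1 free_act_gen mulgV.
  by split=> //; case: (normal_closure_normal artin_rel) => -[].
Qed.

(** The Artin group embeds in [G]: a word in the [sigma i] that is trivial in [G] is a consequence
    of the annular relators, and [annular_to_sd] sends it to [(w, 0)]. *)
Lemma annular_artin_kernel (G : groupType) (sigma : 'Z_m -> G) (tau : G) :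
  presents setT (annular_gen sigma tau) (annular_rel m) ->
  forall w, free_lift sigma w = 1 -> normal_closure artin_rel w.
Proof.
move=> [_ ker] w sw1.
suff : [set u : semidirect rotation | normal_closure artin_rel u.1 /\ u.2 = 0%R]
    (annular_to_sd (free_lift (fun i => gen (Sigma i)) w)).
  by rewrite annular_to_sd_sigma => -[].
apply: (morph_normal_closure (free_liftM _) (sd_normal_closure artin_rel_rotation)).
  exact: annular_rel_sd.
rewrite -ker /= -[LHS]/((free_lift _ \o free_lift _) w).
rewrite (morph_free_lift _ (free_liftM _)) -sw1; congr free_lift.
by apply/funext => i /=; rewrite free_lift_gen.
Qed.

End Artin.

(** * Elimination of [sigma_1] *)

Section CommutatorSubgroup.
Variable m : nat.
Hypothesis m3 : (3 <= m)%N.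
Notation I := (Gamma2_index m).

(* Conjugation x |-> sigma_1^k x sigma_1^-k on the generators p, r, q. *)
Definition shift : int_action I.
Proof.
exists (fun k a => match a with
  | Pidx l => Pidx _ (k + l)%R | Ridx l => Ridx _ (k + l)%R | Qidx i => Qidx i
  end) => [[l|l|i]|k k' [l|l|i]] /=; by rewrite ?add0r ?addrA.
Defined.

(** The word standing for [sigma_i sigma_1^-1]. The default after [insub] is never reached, since
    values in ['Z_m] are at most [m - 1]. *)
Definition letter (i : 'Z_m) : free I :=
  match val i with
  | 0 => gen (Ridx m 0%R)
  | 1 => 1
  | 2 => gen (Pidx m 0%R)
  | n => oapp (fun i : q_range m => gen (Qidx i)) 1 (insub n)
  end.

Lemma Zp_nat_small k : (k < m)%N -> (k%:R : 'Z_m)%R = k :> nat.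
Proof. by move=> km; rewrite val_Zp_nat ?modn_small// ltnW. Qed.

Lemma val_Zp1 : (1%R : 'Z_m) = 1%N :> nat.
Proof. exact: (Zp_nat_small (ltnW m3)). Qed.

Lemma letter0 : letter 0%R = gen (Ridx m 0%R). Proof. by []. Qed.

Lemma letter1 : letter 1%R = 1.
Proof. by rewrite /letter [val _]val_Zp1. Qed.

Lemma letter2 : letter 2%:R%R = gen (Pidx m 0%R).
Proof. by rewrite /letter [val _]Zp_nat_small. Qed.

Lemma letterQ (i : 'Z_m) (q : q_range m) : val i = sval q -> letter i = gen (Qidx q).
Proof.
rewrite /letter; case: q => n nm /= ->; case/andP: (nm).
by case: n nm => [|[|[|n]]] nm // _ _; rewrite insubT.
Qed.

(** Case analysis on this replaces the letter and the value of its index together, so that [lia] can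
    discard impossible pairs of indices. *)
Variant letter_spec : free I -> nat -> Type :=
| LetterR : letter_spec (gen (Ridx m 0%R)) 0
| Letter1 : letter_spec 1 1
| LetterP : letter_spec (gen (Pidx m 0%R)) 2
| LetterQ (q : q_range m) of (3 <= sval q <= m - 1)%N : letter_spec (gen (Qidx q)) (sval q).

Lemma letterP (i : 'Z_m) : letter_spec (letter i) i.
Proof.
have im := ltn_Zp m3 i.
case E: (nat_of_ord i) => [|[|[|n]]]; try by rewrite /letter [val _]E; constructor.
have nm : (3 <= n.+3 <= m - 1)%N by move: im E => /=; lia.
pose q : q_range m := exist (fun k => is_true (3 <= k <= m - 1)%N) _ nm.
by rewrite -[n.+3]/(sval q) (letterQ (q := q) E); constructor.
Qed.

(* sigma_1 becomes the generator of int, and sigma_i becomes (sigma_i sigma_1^-1) sigma_1. *)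
Definition artin_to_sd : free 'Z_m -> semidirect shift :=
  free_lift (fun i => sd shift (letter i) 1%R).

(** Since [sigma_1] goes to [(1, 1)], the powers of [sigma_1] around the middle letter of [p_k] or
    [r_k] shift its index to [k] and bring the exponent back to 0. *)
Lemma artin_to_sdK w :
  artin_to_sd (free_lift (Gamma2_gen (@gen 'Z_m)) w) = sd shift w 0%R.
Proof.
have fM : {morph artin_to_sd : x y / x * y} := free_liftM _.
have gM : {morph (fun w => sd shift w 0%R) : x y / x * y}.
  by move=> x y; rewrite sdM free_act0 addr0.
rewrite (free_lift_unique gM (fun=> erefl)) -[LHS]/((artin_to_sd \o free_lift _) w).
rewrite (morph_free_lift _ fM); congr free_lift; apply/funext => -[k|k|[i im]] /=.
- rewrite /p_elt !fM !(morph_expgz fM) /artin_to_sd !free_lift_gen letter1 letter2.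
  by rewrite !sd_expgz !sdM free_act1 mul1g mulg1 free_act_gen /= addr0 addrN.
- rewrite /r_elt !fM !(morph_expgz fM) /artin_to_sd !free_lift_gen letter1 letter0.
  by rewrite !sd_expgz !sdM free_act1 mul1g mulg1 free_act_gen /= addr0 addrN.
- rewrite /q_elt fM (morphV fM) /artin_to_sd !free_lift_gen letter1 sdF divg1.
  by congr sd; apply: letterQ; rewrite [LHS]Zp_nat_small//; lia.
Qed.

(** Spelled out in the [sigma i], the word [w] follows from the Artin relators by
    [annular_artin_kernel]; [artin_to_sd] carries it into the closure of [rel] and back to [w]. *)
Lemma Gamma2_kernel (G : groupType) (sigma : 'Z_m -> G) (tau : G) (rel : set (free I)) :
  presents setT (annular_gen sigma tau) (annular_rel m) ->
  iact_stable shift rel ->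
  (@artin_rel m `<=` artin_to_sd @^-1` [set u | normal_closure rel u.1 /\ u.2 = 0%R]) ->
  forall w, free_lift (Gamma2_gen sigma) w = 1 -> normal_closure rel w.
Proof.
move=> Hpres rels artin w w1.
suff : [set u : semidirect shift | normal_closure rel u.1 /\ u.2 = 0%R]
    (artin_to_sd (free_lift (Gamma2_gen (@gen 'Z_m)) w)).
  by rewrite artin_to_sdK => -[].
have sub := morph_normal_closure (free_liftM _) (sd_normal_closure rels) artin.
apply: (sub); apply: (annular_artin_kernel m3 Hpres).
rewrite -w1 -[LHS]/((free_lift _ \o free_lift _) w).
rewrite (morph_free_lift _ (free_liftM _)); congr free_lift; apply/funext => a /=.
have fM : {morph free_lift sigma : x y / x * y} := free_liftM _.
by case: a => [k|k|i] /=; rewrite /p_elt /r_elt /q_elt ?(fM, morph_expgz fM, free_liftV, free_lift_gen).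
Qed.

(** * Images of the Artin relators *)

Lemma artin_to_sd_comm i j : artin_to_sd (gen i * gen j / (gen j * gen i)) =
  sd shift ((letter i * free_act shift 1%R (letter j)) /
            (letter j * free_act shift 1%R (letter i))) 0%R.
Proof.
have fM : {morph artin_to_sd : x y / x * y} := free_liftM _.
have E k l : artin_to_sd (gen k * gen l) =
    sd shift (letter k * free_act shift 1%R (letter l)) 2%R.
  by rewrite fM /artin_to_sd !free_lift_gen sdM.
by rewrite fM (morphV fM) !E sdF.
Qed.

Lemma artin_to_sd_braid i j :
  artin_to_sd (gen i * gen j * gen i / (gen j * gen i * gen j)) =
  sd shift
    ((letter i * free_act shift 1%R (letter j) * free_act shift 2%R (letter i)) /
     (letter j * free_act shift 1%R (letter i) * free_act shift 2%R (letter j))) 0%R.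
Proof.
have fM : {morph artin_to_sd : x y / x * y} := free_liftM _.
have E k l : artin_to_sd (gen k * gen l * gen k) = sd shift
    (letter k * free_act shift 1%R (letter l) * free_act shift 2%R (letter k)) 3%R.
  by rewrite !fM /artin_to_sd !free_lift_gen !sdM.
by rewrite fM (morphV fM) !E sdF.
Qed.

(** Exchanging [i] and [j] inverts a commutation relator, and [i = j] makes it trivial, so [i < j]
    suffices. Adjacency is restated on natural numbers for use with [letterP]. *)
Lemma artin_rel_sd (rel : set (free I)) :
  (forall i j : 'Z_m, (i < j)%N -> i.+1 <> j -> ~ (i = 0%N :> nat /\ j = m.-1 :> nat) ->
    normal_closure rel ((letter i * free_act shift 1%R (letter j)) /
                        (letter j * free_act shift 1%R (letter i)))) ->
  (forall i j : 'Z_m, (i.+1 = m /\ j = 0%N :> nat) \/ ((i.+1 < m)%N /\ j = i.+1 :> nat) ->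
    normal_closure rel
    ((letter i * free_act shift 1%R (letter j) * free_act shift 2%R (letter i)) /
     (letter j * free_act shift 1%R (letter i) * free_act shift 2%R (letter j)))) ->
  @artin_rel m `<=` artin_to_sd @^-1`
    [set u | normal_closure rel u.1 /\ u.2 = 0%R].
Proof.
have [sN _] := normal_closure_normal rel.
move=> comm braid _ [i j ij ji|i]; rewrite /preimage /mkset.
  rewrite artin_to_sd_comm; split=> //.
  have nij : ~ (i.+1 = j) /\ ~ (i = 0%N :> nat /\ j = m.-1 :> nat).
    split=> [E|[i0 jm]]; [case/eqP: ji|case/eqP: ij]; apply: val_inj;
      rewrite [RHS](val_Zp_succ m3); last by rewrite jm eqxx.
    by have := ltn_Zp m3 j; case: eqP => ? //; lia.
  have nji : ~ (j.+1 = i) /\ ~ (j = 0%N :> nat /\ i = m.-1 :> nat).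
    split=> [E|[i0 jm]]; [case/eqP: ij|case/eqP: ji]; apply: val_inj;
      rewrite [RHS](val_Zp_succ m3); last by rewrite jm eqxx.
    by have := ltn_Zp m3 i; case: eqP => ? //; lia.
  case: (ltngtP i j) => [lt|lt|/val_inj->]; first by case: nij => *; exact: comm.
    by rewrite -(subgroupVE _ sN) invgF; case: nji => *; exact: comm.
  by rewrite mulgV; case: sN.
rewrite artin_to_sd_braid; split=> //; apply: braid.
by rewrite (val_Zp_succ m3); have := ltn_Zp m3 i; case: ifP => /eqP; lia.
Qed.

(** No two distinct indices are nonadjacent, and the braid relators of the pairs (0,1), (1,2), (2,0)
    give the three families at [k = 0]. Other values of [k] enter through the shift action. *)
Lemma artin_rel_sd_3 : m = 3 ->
  @artin_rel m `<=` artin_to_sd @^-1`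
    [set u | normal_closure (Gamma2_rel_3 m) u.1 /\ u.2 = 0%R].
Proof.
have [sN _] := normal_closure_normal (Gamma2_rel_3 m).
move=> m_eq; apply: artin_rel_sd => i j.
  by have := ltn_Zp m3 i; have := ltn_Zp m3 j; lia.
case: (letterP i) => [|||k ?]; case: (letterP j) => [|||l ?]; try lia.
- move=> _; rewrite -(subgroupVE _ sN) !free_act1 !free_act_gen !groupE.
  by apply: sub_normal_closure; exact: (rel3_r m 0%R).
- move=> _; rewrite !free_act1 !free_act_gen !groupE.
  by apply: sub_normal_closure; exact: (rel3_p m 0%R).
- move=> _; rewrite !free_act_gen -(subgroupVE _ sN) !groupE.
  by apply: sub_normal_closure; exact: (rel3_pr m 0%R).
Qed.

Lemma artin_rel_sd_ge4 : (4 <= m)%N ->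
  @artin_rel m `<=` artin_to_sd @^-1`
    [set u | normal_closure (Gamma2_rel_ge4 m) u.1 /\ u.2 = 0%R].
Proof.
have [sN _] := normal_closure_normal (Gamma2_rel_ge4 m).
have sub := @sub_normal_closure _ (Gamma2_rel_ge4 m).
move=> m4; apply: artin_rel_sd => i j.
(* The nonadjacent pairs, in order: (0,2), then 0, 1 and 2 each with an index at least 3, then two
   indices at least 3. *)
{ case: (letterP i) => [|||k ?]; case: (letterP j) => [|||l ?]; try lia.
  all: move=> *; rewrite ?(free_act1, free_act_gen) !groupE.
  - by apply: sub; exact: (rel_rp m 0%R).
  - by apply: sub; apply: (rel_rq (m := m) 0%R); lia.
  (* For [sigma_1] and [sigma_l] with [l] at least 3 the image is 1, since the shift fixes [q_l]. *)
  - by case: sN.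
  - by apply: sub; apply: (rel_pq (m := m) 0%R); lia.
  - by apply: sub; apply: rel_qq_comm; lia. }
(* The adjacent pairs, in order: (0,1), (1,2), (2,3), (m-1,0), and successive indices at least 3. *)
case: (letterP i) => [|||k ?]; case: (letterP j) => [|||l ?]; try lia.
all: move=> ij; rewrite ?(free_act1, free_act_gen).
- rewrite -(subgroupVE _ sN) !groupE.
  by apply: sub; exact: (rel_r m 0%R).
- rewrite !groupE.
  by apply: sub; exact: (rel_p m 0%R).
- rewrite !groupE.
  by apply: sub; apply: (rel_pq3 (m := m) 0%R); lia.
- rewrite -(subgroupVE _ sN) !groupE.
  by apply: sub; apply: (rel_rq_last (m := m) 0%R); lia.
- by apply: sub; apply: rel_qq_braid; lia.
Qed.

Lemma Gamma2_rel_3_shift : iact_stable shift (Gamma2_rel_3 m).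
Proof.
move=> k _ [l|l|l]; rewrite !(free_actM, free_actV, free_act_gen) /= !(addrA k).
- exact: rel3_p.
- exact: rel3_r.
- exact: rel3_pr.
Qed.

Lemma Gamma2_rel_ge4_shift : iact_stable shift (Gamma2_rel_ge4 m).
Proof.
move=> k _ [l|l|l i i3|l i im|i j *|i j *|l|l i *|l i *];
  rewrite !(free_actM, free_actV, free_act_gen) /= ?(addrA k).
- exact: rel_p.
- exact: rel_r.
- exact: rel_pq3.
- exact: rel_pq.
- exact: rel_qq_comm.
- exact: rel_qq_braid.
- exact: rel_rp.
- exact: rel_rq.
- exact: rel_rq_last.
Qed.

(** * Validity of the relators in the braid group *)

Section Realization.
Variables (G : groupType) (sigma : 'Z_m -> G) (tau : G).
Hypothesis Hpres : presents setT (annular_gen sigma tau) (annular_rel m).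

Notation s := (sigma 1%R).
Notation real := (free_lift (Gamma2_gen sigma)).

Lemma annular_rel_hold x : annular_rel m x -> free_lift (annular_gen sigma tau) x = 1.
Proof. by move=> relx; have [_ /seteqP[_]] := Hpres; apply; exact: sub_normal_closure. Qed.

Lemma sigma_braid i : sigma i * sigma (i + 1)%R * sigma i =
  sigma (i + 1)%R * sigma i * sigma (i + 1)%R.
Proof.
apply: divg1_eq; have := annular_rel_hold (annular_braid i).
by rewrite !(free_liftM, free_liftV, free_lift_gen).
Qed.

Lemma sigma_comm (i j : 'Z_m) : (i.+1 < j)%N -> (j - i < m - 1)%N ->
  sigma i * sigma j = sigma j * sigma i.
Proof.
move=> ij1 ijm; apply: divg1_eq.
have/annular_rel_hold : annular_rel m (gen (Sigma i) * gen (Sigma j) *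
    (gen (Sigma j) * gen (Sigma i))^-1) by apply: annular_comm; lia.
by rewrite !(free_liftM, free_liftV, free_lift_gen).
Qed.

Lemma sigma_tau i : sigma i ^ tau = sigma (i + 1)%R.
Proof.
rewrite conjgE mulgA; apply: divg1_eq; have := annular_rel_hold (annular_shift i).
by rewrite !(free_liftM, free_liftV, free_lift_gen).
Qed.

Lemma sigma1_comm (i : 'Z_m) : (3 <= i)%N -> s * sigma i = sigma i * s.
Proof.
move=> i3; apply: sigma_comm; rewrite val_Zp1 //.
by have := ltn_Zp m3 i; lia.
Qed.

Lemma real_letter i : real (letter i) = sigma i / s.
Proof.
rewrite -{2}[i]natr_Zp; case: (letterP i) => [|||q _]; rewrite ?free_lift_gen.
- by rewrite /= /r_elt mul1g.
- by rewrite free_lift1 mulgV.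
- by rewrite /= /p_elt mul1g.
- by [].
Qed.

(** The sign comes from the convention [x ^ y = y^-1 * x * y]. *)
Lemma real_act k x : real (free_act shift k x) = real x ^ expgz s (- k)%R.
Proof.
rewrite -[LHS]/((real \o free_act shift k) x) (morph_free_lift _ (free_liftM _)).
have cM : {morph (fun x => x ^ expgz s (- k)%R) : x y / x * y}.
  by move=> ? ?; exact: conjMg.
rewrite -[RHS]/(((fun x => x ^ expgz s (- k)%R) \o real) x) (morph_free_lift _ cM).
congr free_lift; apply/funext => -[l|l|[i im]] /=; rewrite free_lift_gen /=.
- rewrite /p_elt conjgE -expgzN opprK !mulgA -expgzD -mulgA -expgzD.
  by rewrite -opprD [(l + 1 + k)%R]addrC addrA.
- rewrite /r_elt conjgE -expgzN opprK !mulgA -expgzD -mulgA -expgzD.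
  by rewrite -opprD [(l + 1 + k)%R]addrC addrA.
(* The shift fixes [q_i], so its realization must commute with powers of [sigma_1]; this holds as
   [i] is at least 3. *)
- rewrite /q_elt; apply/esym/conjg_fixP; apply/commgP/commute_sym.
  have i3 : (3 <= (i%:R%R : 'Z_m))%N by rewrite Zp_nat_small//; lia.
  have c : commute (sigma i%:R%R / s) s by rewrite /commute mulgVK mulgA sigma1_comm// mulgK.
  have cX n : commute (sigma i%:R%R / s) (s ^+ n) := commuteX n c.
  apply: commute_sym; case: (- k)%R => n; rewrite /expgz; first exact: cX.
  exact: commuteV.
Qed.

(* Relators indexed by k need only be checked at k = 0. *)
Lemma real_shift_eq1 k x0 x : real x0 = 1 -> free_act shift k x0 = x -> real x = 1.
Proof. by move=> x01 <-; rewrite real_act x01 conj1g. Qed.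

(** Indices 0, 1 and 2 are the only ones occurring in the relators at [k = 0]. *)
Lemma real_gen :
  (real (gen (Pidx m 0%R)) = sigma 2%:R%R * s^-1) *
  (real (gen (Pidx m 1%R)) = s * sigma 2%:R%R * s^-1 * s^-1) *
  (real (gen (Pidx m 2%R)) = s * s * sigma 2%:R%R * s^-1 * s^-1 * s^-1) *
  (real (gen (Ridx m 0%R)) = sigma 0%R * s^-1) *
  (real (gen (Ridx m 1%R)) = s * sigma 0%R * s^-1 * s^-1) *
  (real (gen (Ridx m 2%R)) = s * s * sigma 0%R * s^-1 * s^-1 * s^-1).
Proof.
have e1 : expgz s (- (1 + 1))%R = s^-1 * s^-1 by rewrite -invgM.
have e2 : expgz s (- (2 + 1))%R = s^-1 * s^-1 * s^-1 by rewrite -!invgM.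
by split; [split; [split; [split; [split|]|]|]|]; rewrite free_lift_gen /= /p_elt /r_elt
  ?e1 ?e2 ?mulgA ?mul1g.
Qed.

Lemma real_genQ (q : q_range m) : real (gen (Qidx q)) = sigma (sval q)%:R%R * s^-1.
Proof. exact: free_lift_gen. Qed.

Lemma real_relp k : real (gen (Pidx m (k + 1)%R) * (gen (Pidx m (k + 2)%R))^-1 *
  (gen (Pidx m k))^-1) = 1.
Proof.
pose x := gen (Pidx m 1%R) * (gen (Pidx m 2%R))^-1 * (gen (Pidx m 0%R))^-1.
apply: (@real_shift_eq1 k x); last by rewrite /x !free_actE /= addr0.
rewrite !(free_liftM, free_liftV) !real_gen !groupE.
by rewrite (sigma_braid 1%R) !groupE.
Qed.

Lemma real_relr k : real (gen (Ridx m (k + 1)%R) * (gen (Ridx m (k + 2)%R))^-1 *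
  (gen (Ridx m k))^-1) = 1.
Proof.
pose x := gen (Ridx m 1%R) * (gen (Ridx m 2%R))^-1 * (gen (Ridx m 0%R))^-1.
apply: (@real_shift_eq1 k x); last by rewrite /x !free_actE /= addr0.
rewrite !(free_liftM, free_liftV) !real_gen !groupE.
by have := sigma_braid 0%R; rewrite add0r => <-; rewrite !groupE.
Qed.

Lemma Gamma2_rel_3_hold : m = 3 -> Gamma2_rel_3 m `<=` [set x | real x = 1].
Proof.
move=> m_eq _ [k|k|k] /=; [exact: real_relp|exact: real_relr|].
pose x := gen (Ridx m 0%R) * gen (Pidx m 1%R) * gen (Ridx m 2%R) *
  (gen (Pidx m 2%R))^-1 * (gen (Ridx m 1%R))^-1 * (gen (Pidx m 0%R))^-1.
apply: (@real_shift_eq1 k x); last by rewrite /x !free_actE /= addr0.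
rewrite !(free_liftM, free_liftV) !real_gen !groupE.
(* For [m = 3] the successor of 2 wraps around, so the relator is the braid relation of [sigma_2]
   and [sigma_0]. *)
have := sigma_braid 2%:R%R; have -> : (2%:R + 1)%R = 0%R :> 'Z_m.
  by apply: val_inj; rewrite [LHS](val_Zp_succ m3) Zp_nat_small// m_eq.
by move=> <-; rewrite !groupE.
Qed.

Lemma Gamma2_rel_ge4_hold : (4 <= m)%N -> Gamma2_rel_ge4 m `<=` [set x | real x = 1].
Proof.
move=> m4.
(* Here [4 <= m] matters: for [m = 3] the indices 0 and 2 are adjacent. *)
have c02 : sigma 0%R * sigma 2%:R%R = sigma 2%:R%R * sigma 0%R.
  have e0 : (0%R : 'Z_m) = 0%N :> nat by [].
  by apply: sigma_comm; rewrite e0 Zp_nat_small//; lia.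
(* Oriented rules that move [s] and [s^-1] to the right past [sigma_q] and its inverse, until
   [groupE] can cancel them. *)
have cs (q : q_range m) : let x := sigma (sval q)%:R%R in
    (forall y, y * s * x = y * x * s) * (forall y, y * s^-1 * x = y * x * s^-1) *
    (forall y, y * s * x^-1 = y * x^-1 * s) *
    (forall y, y * s^-1 * x^-1 = y * x^-1 * s^-1) * (s * x = x * s).
  have [q3 qm] : (3 <= sval q)%N /\ (sval q < m)%N by case: q => n /= ?; lia.
  have c : commute s (sigma (sval q)%:R%R) by apply: sigma1_comm; rewrite Zp_nat_small//; lia.
  have cV := commuteV c; have Vc := commute_sym (commuteV (commute_sym c)).
  have VcV := commuteV Vc.
  by split; [split; [split; [split|]|]|] => * //; rewrite -!mulgA; congr (_ * _).
have qb (q : q_range m) : (3 <= sval q)%N /\ (sval q < m)%N by case: q => n /= ?; lia.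
have cQ (q : q_range m) n : (n.+1 < sval q)%N -> (sval q - n < m - 1)%N ->
    sigma n%:R%R * sigma (sval q)%:R%R = sigma (sval q)%:R%R * sigma n%:R%R.
  have [q1 q2] := qb q => qn nm; apply: sigma_comm; rewrite !Zp_nat_small//; lia.
move=> _ [k|k|k i i3|k i im|i j i3 ij jm|i j im ij|k|k i im|k i im];
  [exact: real_relp|exact: real_relr|rewrite /mkset..]; try have [qi1 qi2] := qb i.
- pose x := gen (Pidx m 0%R) * gen (Qidx i) * gen (Pidx m 2%R) *
    (gen (Qidx i))^-1 * (gen (Pidx m 1%R))^-1 * (gen (Qidx i))^-1.
  apply: (@real_shift_eq1 k x); last by rewrite /x !free_actE /= addr0.
  rewrite !(free_liftM, free_liftV) !real_genQ !real_gen ?(groupE, cs).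
  by have := sigma_braid 2%:R%R; rewrite i3 natr1 => ->; rewrite !groupE.
- pose x := gen (Pidx m 0%R) * gen (Qidx i) * (gen (Pidx m 1%R))^-1 * (gen (Qidx i))^-1.
  apply: (@real_shift_eq1 k x); last by rewrite /x !free_actE /= addr0.
  rewrite !(free_liftM, free_liftV) !real_genQ !real_gen ?(groupE, cs).
  by rewrite cQ ?groupE//; lia.
- have [qj1 qj2] := qb j.
  rewrite !(free_liftM, free_liftV) !real_genQ ?(groupE, cs).
  by rewrite cQ ?groupE//; lia.
- rewrite !(free_liftM, free_liftV) !real_genQ ?(groupE, cs).
  by rewrite ij natrD sigma_braid !groupE.
- pose x := gen (Ridx m 0%R) * gen (Pidx m 1%R) * (gen (Ridx m 1%R))^-1 * (gen (Pidx m 0%R))^-1.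
  apply: (@real_shift_eq1 k x); last by rewrite /x !free_actE /= addr0.
  rewrite !(free_liftM, free_liftV) !real_gen ?(groupE, cs).
  by rewrite c02 !groupE.
- pose x := gen (Ridx m 0%R) * gen (Qidx i) * (gen (Ridx m 1%R))^-1 * (gen (Qidx i))^-1.
  apply: (@real_shift_eq1 k x); last by rewrite /x !free_actE /= addr0.
  rewrite !(free_liftM, free_liftV) !real_genQ !real_gen ?(groupE, cs).
  by rewrite (cQ i 0%N) ?groupE//; lia.
- pose x := gen (Ridx m 0%R) * gen (Qidx i) * gen (Ridx m 2%R) *
    (gen (Qidx i))^-1 * (gen (Ridx m 1%R))^-1 * (gen (Qidx i))^-1.
  apply: (@real_shift_eq1 k x); last by rewrite /x !free_actE /= addr0.
  rewrite !(free_liftM, free_liftV) !real_genQ !real_gen ?(groupE, cs).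
  have := sigma_braid (sval i)%:R%R.
  have -> : ((sval i)%:R + 1)%R = 0%R :> 'Z_m.
    by apply: val_inj; rewrite [LHS](val_Zp_succ m3) Zp_nat_small// im; case: eqP => //; lia.
  by move=> <-; rewrite !groupE.
Qed.

(** * Generation of the commutator subgroup *)

Notation K := (range real).

(** Successive generators are conjugate under [tau], so their quotient is a commutator; the general
    quotient telescopes through [sigma 0]. *)
Lemma Gamma2_sigma_div i j : Gamma2 G (sigma i / sigma j).
Proof.
have sG := (Gamma2_normal G).1.
have G0 k : Gamma2 G (sigma k / sigma 0%R).
  rewrite -[k]natr_Zp; elim: (nat_of_ord k) => [|n IH].
    by rewrite mulgV; case: sG.
  rewrite -(divgKA (sigma n%:R%R)); apply: (subgroupM sG) => //.
  have -> : sigma n.+1%:R%R / sigma n%:R%R = [~ tau, (sigma n%:R%R)^-1].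
    by rewrite -natr1 -sigma_tau commgEl !conjgE !groupE.
  by apply: sub_generated; exists tau => //; exists (sigma n%:R%R)^-1.
rewrite -(mulgKA (sigma 0%R)^-1); case: sG => _; apply; exact: G0.
Qed.

Lemma Gamma2_genE a : exists j k, Gamma2_gen sigma a = (sigma j / s) ^ expgz s k.
Proof.
have E k j : expgz s k * sigma j * expgz s (- (k + 1))%R =
    (sigma j / s) ^ expgz s (- k)%R.
  rewrite conjgE -expgzN opprK !mulgA -[RHS]mulgA; congr (_ * _).
  by rewrite opprD addrC expgzD.
case: a => [k|k|i]; first by exists 2%:R%R, (- k)%R; exact: E.
  by exists 0%R, (- k)%R; exact: E.
by exists (sval i)%:R%R, 0%R; rewrite [RHS]conjg1.
Qed.

Lemma Gamma2_gen_mem a : Gamma2 G (Gamma2_gen sigma a).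
Proof.
have [_ GJ] := Gamma2_normal G; have [j [k ->]] := Gamma2_genE a.
by apply: GJ; exact: Gamma2_sigma_div.
Qed.

Lemma K_sigma_div i j : K (sigma i / sigma j).
Proof.
exists (letter i / letter j) => //.
by rewrite free_liftM free_liftV !real_letter mulgKA.
Qed.

(** Conjugation by [sigma_1] realizes the shift, and [sigma i] differs from [sigma_1] by the factor
    [sigma i / s] in [K]. *)
Lemma K_normalizer_sigma i : normalizer K (sigma i).
Proof.
have KS := range_free_lift_subgroup (Gamma2_gen sigma).
have Ks : normalizer K s.
  move=> _ [w _ <-]; split; [exists (free_act shift (-1)%R w)|exists (free_act shift 1%R w)];
    by rewrite // real_act ?opprK.
rewrite -(mulgVK s (sigma i)).
apply: (subgroupM (normalizer_subgroup K)) => //.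
by apply: sub_normalizer => //; exact: K_sigma_div.
Qed.

Lemma K_normalizer_tau : normalizer K tau.
Proof.
have KS := range_free_lift_subgroup (Gamma2_gen sigma).
(* A general [l] is needed: conjugation by [tau] or its inverse turns the conjugating powers of
   [sigma_1] into powers of [sigma_2] or [sigma_0]. *)
have KJ i j l k : K ((sigma i / sigma j) ^ expgz (sigma l) k).
  have Nl := subgroup_expgz k (normalizer_subgroup K) (K_normalizer_sigma l).
  exact: (Nl _ (K_sigma_div i j)).1.
have sigma_tauV i : sigma i ^ tau^-1 = sigma (i - 1)%R.
  by rewrite -[i in LHS](subrK 1%R) -sigma_tau conjgK.
have conj_sub y : (forall a, K (Gamma2_gen sigma a ^ y)) -> forall x, K x -> K (x ^ y).
  move=> Ky x Kx; rewrite range_free_lift in Kx.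
  have sub : is_subgroup [set x | K (x ^ y)].
    split=> [|u v Ku Kv] /=; first by rewrite conj1g; case: KS.
    by rewrite conjMg conjVg; case: KS => _; exact.
  by apply: (generated_sub sub _ Kx) => _ [a _ <-]; exact: Ky.
have conj_expgz x k y : expgz x k ^ y = expgz (x ^ y) k.
  by rewrite (@morph_expgz _ _ (fun x => x ^ y))// => ? ?; exact: conjMg.
move=> x Kx; split; apply: conj_sub Kx => a; have [j [k ->]] := Gamma2_genE a.
  by rewrite conjJg conj_expgz conjMg conjVg !sigma_tau; exact: KJ.
by rewrite conjJg conj_expgz conjMg conjVg !sigma_tauV; exact: KJ.
Qed.

Lemma generated_annular : generated (range (annular_gen sigma tau)) = setT.
Proof. by rewrite -range_free_lift; case: Hpres. Qed.

Lemma Gamma2_range : Gamma2 G = K.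
Proof.
have KS := range_free_lift_subgroup (Gamma2_gen sigma).
have nK : is_normal K.
  apply: (generated_normal KS generated_annular) => _ [[i|] _ <-].
    exact: K_normalizer_sigma.
  exact: K_normalizer_tau.
apply/seteqP; split; last first.
  rewrite range_free_lift; apply: generated_sub; first exact: (Gamma2_normal G).1.
  by move=> _ [a _ <-]; exact: Gamma2_gen_mem.
(* The commutator is [(sigma i)^-1 * sigma (i + 1)], a quotient of generators up to cyclic order of
   the factors. *)
have Kst i : K [~ sigma i, tau].
  by rewrite commgEl sigma_tau; apply/(normalMC _ _ nK); exact: K_sigma_div.
apply: (commutator_sub nK generated_annular) => _ _ [[i|] _ <-] [[j|] _ <-];
  rewrite /annular_gen.
(* Modulo [K] the two generators agree, so their commutator is a product of conjugates of [d^-1] and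
   [d]. *)
- have Kij := K_sigma_div i j; set d := sigma i / sigma j in Kij.
  have -> : [~ sigma i, sigma j] = (d^-1 ^ sigma j) * (d ^ (sigma j * sigma j)).
    by rewrite commgEl !conjgE /d !groupE.
  by apply: (subgroupM KS); apply: nK.2 => //; exact: (subgroupV KS).
- exact: Kst.
- by rewrite -invgR; apply: (subgroupV KS); exact: Kst.
- by rewrite commgg; case: KS.
Qed.

(** The first hypothesis puts the closure of [rel] inside the kernel; the other two give the reverse
    inclusion through [Gamma2_kernel]. *)
Lemma Gamma2_presents (rel : set (free I)) :
  rel `<=` [set x | real x = 1] -> iact_stable shift rel ->
  @artin_rel m `<=` artin_to_sd @^-1` [set u | normal_closure rel u.1 /\ u.2 = 0%R] ->
  presents (Gamma2 G) (Gamma2_gen sigma) rel.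
Proof.
move=> hold stab artin; split; first by rewrite Gamma2_range.
apply/seteqP; split=> [x /= x1|]; first exact: (Gamma2_kernel Hpres stab artin x1).
apply: normal_closure_sub hold; exact: kernel_normal (free_liftM _).
Qed.

End Realization.

End CommutatorSubgroup.

Theorem proposition58 (R : realType) (x1 x2 : sphere2 R) (x12 : x1 <> x2)
    (m : nat) (m3 : (3 <= m)%N)
    (b : unordered_conf (punctured_sphere x1 x2) m)
    (sigma : 'Z_m -> braid_group R b) (tau : braid_group R b)
    (Hpres : presents [set: braid_group R b]
               (annular_gen sigma tau) (annular_rel m)) :
  [/\ Gamma2 (braid_group R b) =
        generated (range (p_elt sigma) `|` range (r_elt sigma) `|`
                   [set q_elt sigma i | i in [set i : nat | (3 <= i <= m - 1)%N]]),
      m = 3 ->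
        presents (Gamma2 (braid_group R b)) (Gamma2_gen sigma)
          (Gamma2_rel_3 m)
    & (4 <= m)%N ->
        presents (Gamma2 (braid_group R b)) (Gamma2_gen sigma)
          (Gamma2_rel_ge4 m)].
Proof.
split=> [|m_eq|m4].
- rewrite (Gamma2_range m3 Hpres) range_free_lift; congr generated.
  apply/seteqP; split=> [_ [[k|k|i] _ <-]|_ [[[k _ <-]|[k _ <-]]|[i im <-]]].
  + by left; left; exists k.
  + by left; right; exists k.
  + by right; exists (sval i) => //; case: i.
  + by exists (Pidx m k).
  + by exists (Ridx m k).
  + by exists (Qidx (exist (fun i => is_true (3 <= i <= m - 1)%N) i im)).
- apply: (Gamma2_presents m3 Hpres).
  + exact: (Gamma2_rel_3_hold m3 Hpres).
  + exact: Gamma2_rel_3_shift.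
  + exact: artin_rel_sd_3.
- apply: (Gamma2_presents m3 Hpres).
  + exact: (Gamma2_rel_ge4_hold m3 Hpres).
  + exact: Gamma2_rel_ge4_shift.
  + exact: artin_rel_sd_ge4.
Qed.
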